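(* Let $n\ge 1$, let $\mathcal{H}_S$ be a Hilbert space and let $\mathcal{H}_I\cong\mathbb{C}^n$ have orthonormal basis $\{|i\rangle\}_{i=0}^{n-1}$, where $|n\rangle$ is identified with $|0\rangle$. Let $H_0=-P_0$ be a Hamiltonian on $\mathcal{H}_S\otimes\mathcal{H}_I$, where $P_0=\Gamma_0\otimes|0\rangle\langle 0|_I$ (with $\Gamma_0\neq 0$ an orthogonal projection on $\mathcal{H}_S$) is the projection onto the ground space of $H_0$. Let $M_0,\ldots,M_{n-1}$ be operators on $\mathcal{H}_S$ (indices taken modulo $n$) such that for all $i$: (i) $M_iM_{i+1}M_{i+1}^\dagger M_i^\dagger\propto (M_iM_i^\dagger)^2$, (ii) $(M_iM_i^\dagger)^2\propto M_iM_i^\dagger$, (iii) $M_iM_i^\dagger\propto M_{i-1}^\dagger M_{i-1}$, (iv) $\Gamma_0M_0M_0^\dagger\Gamma_0\propto\Gamma_0$. Let $$V=\sum_{i=0}^{n-1}\left(M_i^\dagger\otimes|i+1\rangle\langle i|_I+M_i\otimes|i\rangle\langle i+1|_I\right)$$ and $H=H_0+\lambda V$ with $\lambda\ge 0$. Then there exists a function $f(\lambda)$ such that for $$\lambda<\frac{1}{16\max_i\|M_i\|}$$ the shifted effective Hamiltonian satisfies $$\tilde H_{\mathrm{eff}}(f(\lambda))=(-1)^{n-1}\lambda^n\,H_{\mathrm{target}}\otimes|0\rangle\langle 0|_I+O(\lambda^{n+1}),$$ where $$H_{\mathrm{target}}=\Gamma_0M_0\cdots M_{n-1}\Gamma_0+\Gamma_0M_{n-1}^\dagger\cdots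 M_0^\dagger\Gamma_0 .$$
   Context: All Hilbert spaces are finite-dimensional. For operators $A,B$ write $A\propto B$ if there is a scalar $c$ with $A=cB$. $\|\cdot\|$ is the operator norm. Effective Hamiltonian: let $H_0$ be a Hermitian operator with $d$-dimensional ground space (eigenspace of the smallest eigenvalue), $V$ Hermitian, and $H=H_0+\lambda V$. Let $|\varphi_1\rangle,\ldots,|\varphi_d\rangle$ be orthonormal eigenvectors of $H$ corresponding to its $d$ lowest eigenvalues $E_1,\ldots,E_d$ (counted with multiplicity). Put $H_{\mathrm{eff}}=\sum_{i=1}^dE_i|\varphi_i\rangle\langle\varphi_i|$, $\Pi=\sum_{i=1}^d|\varphi_i\rangle\langle\varphi_i|$, and for a real number $\delta$ define the shifted effective Hamiltonian $\tilde H_{\mathrm{eff}}(\delta)=H_{\mathrm{eff}}-\delta\,\Pi$. $O(\lambda^k)$ denotes an operator whose norm is bounded by a constant (independent of $\lambda$) times $\lambda^k$ as $\lambda\to 0$. *)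

(* Defs.v *)
From HB Require Import structures.
From mathcomp Require Import all_boot all_order all_algebra.
From mathcomp Require Import complex mxtens.
From mathcomp Require Import mathcomp_extra boolp classical_sets reals.

Set Implicit Arguments.
Unset Strict Implicit.
Unset Printing Implicit Defensive.

Import Order.TTheory GRing.Theory Num.Theory.
Local Open Scope ring_scope.
Local Open Scope complex_scope.
Local Open Scope sesquilinear_scope.
Local Open Scope classical_set_scope.

Section Operators.
Variable R : realType.
Local Notation C := R[i].

(* An N-dimensional Hilbert space is C^N with its standard inner product; kets
   are column vectors, bras are their adjoints, and |phi><psi| is
   phi *m psi^t*. *)

Definition l2norm N (v : 'cV[C]_N) : R :=
  Num.sqrt (\sum_(k < N) (complex.Re (v k 0) ^+ 2 + complex.Im (v k 0) ^+ 2)).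

Definition opnorm N (A : 'M[C]_N) : R :=
  sup [set l2norm (A *m v) | v in [set v : 'cV[C]_N | l2norm v <= 1]].

Definition propto N (A B : 'M[C]_N) : Prop := exists c : C, A = c *: B.

Definition hermitian_op N (A : 'M[C]_N) : Prop := A^t* = A.

Definition orthogonal_projection N (P : 'M[C]_N) : Prop :=
  hermitian_op P /\ P *m P = P.

(* MathComp eigenspaces consist of row vectors; for Hermitian H0 they are the
   adjoints of the usual ones, with the same dimension.  On R[i] the relation
   E0 <= a says that a - E0 is a nonnegative real. *)
Definition ground_space_dim N (H0 : 'M[C]_N) (d : nat) : Prop :=
  exists E0 : C,
    [/\ eigenvalue H0 E0,
        forall a : C, eigenvalue H0 a -> E0 <= a &
        d = \rank (eigenspace H0 E0)].

(* s lists all the eigenvalues of H in nondecreasing order, repeated according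
   to multiplicity. *)
Definition sorted_spectrum N (H : 'M[C]_N) (s : seq R) : Prop :=
  sorted <=%R s /\ char_poly H = \prod_(x <- s) ('X - (x%:C)%:P).

Definition orthonormal_family N d (phi : 'I_d -> 'cV[C]_N) : Prop :=
  forall i j : 'I_d, (phi i)^t* *m phi j = ((i == j)%:R)%:M.

Definition lowest_eigensystem N (H : 'M[C]_N) d
    (E : 'I_d -> R) (phi : 'I_d -> 'cV[C]_N) : Prop :=
  [/\ exists2 s : seq R, sorted_spectrum H s & forall i : 'I_d, E i = s`_i,
      orthonormal_family phi &
      forall i : 'I_d, H *m phi i = (E i)%:C *: phi i].

Definition Heff N d (E : 'I_d -> R) (phi : 'I_d -> 'cV[C]_N) : 'M[C]_N :=
  \sum_(i < d) (E i)%:C *: (phi i *m (phi i)^t*).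

Definition low_projection N d (phi : 'I_d -> 'cV[C]_N) : 'M[C]_N :=
  \sum_(i < d) phi i *m (phi i)^t*.

Definition shifted_Heff N d (E : 'I_d -> R) (phi : 'I_d -> 'cV[C]_N)
    (delta : R) : 'M[C]_N :=
  Heff E phi - delta%:C *: low_projection phi.

Definition ketbra n (i j : 'I_n) : 'M[C]_n := delta_mx i j.

(* ordS is the cyclic successor on 'I_n, so that |n> is |0>. *)
Definition cyclic_V n m (M : 'I_n -> 'M[C]_m) : 'M[C]_(m * n) :=
  \sum_(i < n) ((M i)^t* *t ketbra (ordS i) i + M i *t ketbra i (ordS i)).

(* Products of matrices are ordered by increasing index; rev_ord makes the
   second one run from n-1 down to 0. *)
Definition Htarget n m (Gamma0 : 'M[C]_m) (M : 'I_n -> 'M[C]_m) : 'M[C]_m :=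
  Gamma0 *m (\big[mulmx/1%:M]_(i < n) M i) *m Gamma0
  + Gamma0 *m (\big[mulmx/1%:M]_(i < n) (M (rev_ord i))^t*) *m Gamma0.

End Operators.

(* Main.v *)
(* The operators M_i are scaled partial isometries between consecutive projections
   Q_i, so V moves a vector of the ground space along two chains around the ring:
   forward to F_k = M_(k-1)^* ... M_0^* Gamma0 at site k, and backward to
   C_j = M_(n-j) ... M_(n-1) Gamma0 at site n-j; every return to the previous site
   only produces a scalar.  Until the ring is closed, perturbation theory therefore
   shifts the whole ground space by one scalar f.  Concretely, there are scalars
   x_k, y_j, z with X = P0 + z Q_0 Gamma0 + sum_k x_k F_k + sum_j y_j C_j and
   (H - f) X = (-1)^(n-1) lambda^n (F_n + C_n) + O(lambda^(n+1)): up to that error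
   they solve a fixed point equation that is contracting by a factor O(lambda).
   As the low-energy projection Pi is O(lambda)-close to P0, this determines
   (H - f) Pi up to O(lambda^(n+1)).  For lambda away from 0 the estimate only
   says that the effective Hamiltonian is bounded. *)
Require Import Defs.
From mathcomp Require Import all_boot all_order all_algebra.
From mathcomp Require Import complex mxtens.
From mathcomp Require Import mathcomp_extra boolp classical_sets reals.
From mathcomp Require Import ring lra zify.

Set Implicit Arguments.
Unset Strict Implicit.
Unset Printing Implicit Defensive.

Import Order.TTheory GRing.Theory Num.Theory.
Local Open Scope ring_scope.
Local Open Scope complex_scope.
Local Open Scope sesquilinear_scope.

(** * The entrywise l1 norm *)

Section Norm.
Variable R : realType.
Local Notation C := R[i].
Local Notation normc := (@Normc.normc R).

(** This norm is submultiplicative, invariant under adjoints and dominates the operator norm, so all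
    estimates use it and pass to [opnorm] only at the end. *)
Definition nrm p q (A : 'M[C]_(p, q)) : R := \sum_i \sum_j normc (A i j).

Lemma normc_ge0 x : 0 <= normc x.
Proof. by case: x => a b; exact: sqrtr_ge0. Qed.

Lemma normcC (x : R) : normc x%:C = `|x|.
Proof. by rewrite /= expr0n /= addr0 sqrtr_sqr. Qed.

Lemma normc_conj x : normc (x^* )%R = normc x.
Proof. by apply: complexI; exact: (norm_conjC (x : C)). Qed.

Lemma normc_sum (I : finType) (F : I -> C) :
  normc (\sum_i F i) <= \sum_i normc (F i).
Proof.
elim/big_ind2: _ => [|x a y b xa yb|//]; first by rewrite Normc.normc0.
by apply: le_trans (le_normcD _ _) _; rewrite lerD.
Qed.

Lemma nrm_ge0 p q (A : 'M_(p, q)) : 0 <= nrm A.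
Proof. by do 2!apply: sumr_ge0 => ? _; exact: normc_ge0. Qed.

Lemma nrm0 p q : nrm (0 : 'M_(p, q)) = 0.
Proof. by apply: big1 => i _; apply: big1 => j _; rewrite mxE Normc.normc0. Qed.

Lemma le_entry_nrm p q (A : 'M_(p, q)) i j : normc (A i j) <= nrm A.
Proof.
rewrite /nrm (bigD1 i) //= (bigD1 j) //= -addrA lerDl addr_ge0 //.
  by apply: sumr_ge0 => *; exact: normc_ge0.
by do 2!apply: sumr_ge0 => *; exact: normc_ge0.
Qed.

Lemma nrm_entry_le p q (A : 'M_(p, q)) b :
  (forall i j, normc (A i j) <= b) -> nrm A <= p%:R * (q%:R * b).
Proof.
move=> Ab; apply: (@le_trans _ _ (\sum_(i < p) \sum_(j < q) b)).
  by do 2!apply: ler_sum => ? _.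
by rewrite !sumr_const !card_ord -[_ *+ p]mulr_natl -[_ *+ q]mulr_natl.
Qed.

Lemma nrm_eq0 p q (A : 'M_(p, q)) : nrm A <= 0 -> A = 0.
Proof.
move=> A0; apply/matrixP => i j; rewrite mxE; apply: Normc.eq0_normc.
by apply/eqP; rewrite eq_le normc_ge0 andbT (le_trans (le_entry_nrm _ _ _) A0).
Qed.

Lemma nrmD p q (A B : 'M_(p, q)) : nrm (A + B) <= nrm A + nrm B.
Proof.
rewrite /nrm -big_split ler_sum //= => i _; rewrite -big_split ler_sum //= => j _.
by rewrite mxE le_normcD.
Qed.

Lemma nrmZ p q (c : C) (A : 'M_(p, q)) : nrm (c *: A) = normc c * nrm A.
Proof.
rewrite /nrm mulr_sumr; apply: eq_bigr => i _; rewrite mulr_sumr.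
by apply: eq_bigr => j _; rewrite mxE Normc.normcM.
Qed.

Lemma nrmN p q (A : 'M_(p, q)) : nrm (- A) = nrm A.
Proof.
by apply: eq_bigr => i _; apply: eq_bigr => j _; rewrite mxE normcN.
Qed.

Lemma nrmB p q (A B : 'M_(p, q)) : nrm (A - B) <= nrm A + nrm B.
Proof. by rewrite -(nrmN B) nrmD. Qed.

Lemma nrm_sum p q (I : finType) (F : I -> 'M_(p, q)) :
  nrm (\sum_i F i) <= \sum_i nrm (F i).
Proof.
elim/big_ind2: _ => [|x a y b xa yb|//]; first by rewrite nrm0.
by apply: le_trans (nrmD _ _) _; rewrite lerD.
Qed.

Lemma nrmM p q r (A : 'M_(p, q)) (B : 'M_(q, r)) : nrm (A *m B) <= nrm A * nrm B.
Proof.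
rewrite /nrm mulr_suml ler_sum // => i _.
apply: (@le_trans _ _ (\sum_k \sum_j normc (A i j) * normc (B j k))).
  rewrite ler_sum // => k _; rewrite mxE; apply: le_trans (normc_sum _) _.
  by rewrite ler_sum // => j _; rewrite Normc.normcM.
rewrite exchange_big /= mulr_suml ler_sum // => j _; rewrite -mulr_sumr.
rewrite ler_wpM2l ?normc_ge0 // (bigD1 j) //= lerDl.
by do 2!apply: sumr_ge0 => *; exact: normc_ge0.
Qed.

Lemma nrm_adj p q (A : 'M[C]_(p, q)) : nrm (A^t* ) = nrm A.
Proof.
rewrite /nrm exchange_big; apply: eq_bigr => i _; apply: eq_bigr => j _.
by rewrite !mxE normc_conj.
Qed.

Lemma normc_sqr (x : C) : x * (x^* )%R = (normc x ^+ 2)%:C.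
Proof. by rewrite -normCK rmorphXn. Qed.

Lemma mxtrace_mul_adj p q (A : 'M[C]_(p, q)) :
  \tr (A *m A^t* ) = (\sum_i \sum_j normc (A i j) ^+ 2)%:C.
Proof.
rewrite rmorph_sum; apply: eq_bigr => i _; rewrite mxE rmorph_sum.
by apply: eq_bigr => j _; rewrite !mxE normc_sqr.
Qed.

Lemma le_l2norm_nrm p (v : 'cV[C]_p) : l2norm v <= nrm v.
Proof.
rewrite /l2norm -(ger0_norm (nrm_ge0 v)) -sqrtr_sqr ler_wsqrtr //.
have -> : nrm v = \sum_k normc (v k 0).
  by apply: eq_bigr => k _; rewrite big_ord1.
rewrite expr2 mulr_suml ler_sum // => k _.
rewrite (_ : _ + _ = normc (v k 0) * normc (v k 0)); last first.
  by case: (v k 0) => a b /=; rewrite -expr2 sqr_sqrtr // addr_ge0 // sqr_ge0.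
by rewrite ler_wpM2l ?normc_ge0 // (bigD1 k) //= lerDl sumr_ge0 // => *;
  exact: normc_ge0.
Qed.

Lemma normc_le_l2norm p (v : 'cV[C]_p) k : normc (v k 0) <= l2norm v.
Proof.
rewrite /l2norm; case E : (v k 0) => [a b] /=.
rewrite ler_wsqrtr // (bigD1 k) //= E /= lerDl.
by apply: sumr_ge0 => *; rewrite addr_ge0 // sqr_ge0.
Qed.

(** Entries of a vector in the unit ball have modulus at most 1, so each entry of A v is at most the
    l1 norm of its row of A. This is also the boundedness that gives the [sup] in [opnorm] a
    meaning. *)
Lemma opnorm_ubound p (A : 'M[C]_p) :
  ubound [set l2norm (A *m v) | v in [set v : 'cV[C]_p | l2norm v <= 1]]%classic
    (nrm A).
Proof.
move=> _ [v /= v1 <-]; apply: le_trans (le_l2norm_nrm _) _.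
rewrite /nrm ler_sum // => i _; rewrite big_ord1 mxE.
apply: le_trans (normc_sum _) _; rewrite ler_sum // => j _.
by rewrite Normc.normcM ler_piMr ?normc_ge0 // (le_trans (normc_le_l2norm _ _)).
Qed.

Lemma opnorm_le_nrm p (A : 'M[C]_p) : opnorm A <= nrm A.
Proof.
apply: ge_sup; last exact: opnorm_ubound.
exists (l2norm (A *m 0)), 0 => //=; apply: le_trans (le_l2norm_nrm _) _.
by rewrite nrm0.
Qed.

Lemma l2norm_le_opnorm p (A : 'M[C]_p) (v : 'cV[C]_p) :
  l2norm v <= 1 -> l2norm (A *m v) <= opnorm A.
Proof.
by move=> v1; apply: ub_le_sup; [exists (nrm A); exact: opnorm_ubound|exists v].
Qed.

Lemma opnorm_eq0 p (A : 'M[C]_p) : opnorm A <= 0 -> A = 0.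
Proof.
move=> A0; apply/matrixP => i j; rewrite mxE; apply: Normc.eq0_normc.
apply/eqP; rewrite eq_le normc_ge0 andbT.
have -> : A i j = (A *m delta_mx j (0 : 'I_1)) i 0 by rewrite -colE mxE.
apply: le_trans (normc_le_l2norm _ _) (le_trans (l2norm_le_opnorm _ _) A0).
rewrite /l2norm (bigD1 j) //= big1 => [|k kj]; rewrite !mxE.
  by rewrite !eqxx /= !expr0n /= expr1n !addr0 sqrtr1.
by rewrite (negPf kj) /= expr0n addr0.
Qed.

End Norm.

(** * Asymptotics on [0, 1] and dressed amplitudes *)

Section BigO.
Variable R : realType.
Local Notation C := R[i].
Implicit Types (s t : R -> R) (k a b : nat).

(** A fixed interval stands for the limit l -> 0: bounds combine without shrinking neighbourhoods,
    and exponents may be lowered because l <= 1. *)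
Definition sO k s := exists K : R, forall l, 0 <= l <= 1 -> `|s l| <= K * l ^+ k.

Lemma sO_ext k s t : s =1 t -> sO k s -> sO k t.
Proof. by move=> st [K sK]; exists K => l l01; rewrite -st sK. Qed.

Lemma sO_pos k s : sO k s ->
  exists2 K, 0 <= K & forall l, 0 <= l <= 1 -> `|s l| <= K * l ^+ k.
Proof.
move=> [K sK]; exists `|K| => // l l01; apply: le_trans (sK l l01) _.
by case/andP: l01 => l0 _; rewrite ler_wpM2r ?exprn_ge0 ?ler_norm.
Qed.

Lemma sO_le b a s : (a <= b)%N -> sO b s -> sO a s.
Proof.
move=> ab /sO_pos[K K0 sK]; exists K => l l01; apply: le_trans (sK l l01) _.
by case/andP: l01 => l0 l1; rewrite ler_wpM2l // ler_wiXn2l.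
Qed.

Lemma sO_cst c : sO 0 (fun=> c).
Proof. by exists `|c| => l _; rewrite expr0 mulr1. Qed.

Lemma sO_pow k : sO k (fun l => l ^+ k).
Proof.
by exists 1 => l /andP[l0 _]; rewrite mul1r ger0_norm // exprn_ge0.
Qed.

Lemma sO0 k : sO k (fun=> 0).
Proof. by exists 0 => l _; rewrite normr0 mul0r. Qed.

Lemma sOD k s t : sO k s -> sO k t -> sO k (fun l => s l + t l).
Proof.
move=> [K sK] [L tL]; exists (K + L) => l l01.
by rewrite mulrDl (le_trans (ler_normD _ _)) // lerD ?sK ?tL.
Qed.

Lemma sON k s : sO k s -> sO k (fun l => - s l).
Proof. by move=> [K sK]; exists K => l l01; rewrite normrN sK. Qed.

Lemma sOB k s t : sO k s -> sO k t -> sO k (fun l => s l - t l).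
Proof. by move=> sk tk; apply: sOD => //; exact: sON. Qed.

Lemma sOM a b k s t : (k <= a + b)%N ->
  sO a s -> sO b t -> sO k (fun l => s l * t l).
Proof.
move=> kab [K sK] [L tL]; apply: (sO_le kab); exists (K * L) => l l01.
by rewrite normrM exprD mulrACA ler_pM ?sK ?tL.
Qed.

Lemma sOZ k c s : sO k s -> sO k (fun l => c * s l).
Proof. by apply: sOM (sO_cst c). Qed.

Variables p q : nat.
Implicit Types A B : R -> 'M[C]_(p, q).

Definition mO k A := exists K : R, forall l, 0 <= l <= 1 -> nrm (A l) <= K * l ^+ k.

Lemma mO_ext k A B : A =1 B -> mO k A -> mO k B.
Proof. by move=> AB [K AK]; exists K => l l01; rewrite -AB AK. Qed.

Lemma mO_pos k A : mO k A ->
  exists2 K, 0 <= K & forall l, 0 <= l <= 1 -> nrm (A l) <= K * l ^+ k.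
Proof.
move=> [K sK]; exists `|K| => // l l01; apply: le_trans (sK l l01) _.
by case/andP: l01 => l0 _; rewrite ler_wpM2r ?exprn_ge0 ?ler_norm.
Qed.

Lemma mO0 k : mO k (fun=> 0).
Proof. by exists 0 => l _; rewrite nrm0 mul0r. Qed.

Lemma mOD k A B : mO k A -> mO k B -> mO k (fun l => A l + B l).
Proof.
move=> [K AK] [L BL]; exists (K + L) => l l01.
by rewrite mulrDl (le_trans (nrmD _ _)) // lerD ?AK ?BL.
Qed.

Lemma mOZ k s (A : 'M[C]_(p, q)) : sO k s -> mO k (fun l => (s l)%:C *: A).
Proof.
move=> [K sK]; exists (K * nrm A) => l l01; rewrite nrmZ normcC mulrAC.
by rewrite ler_wpM2r ?nrm_ge0 ?sK.
Qed.

Lemma mO_sum k (I : finType) (P : pred I) (F : I -> R -> 'M[C]_(p, q)) :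
  (forall i, P i -> mO k (F i)) -> mO k (fun l => \sum_(i | P i) F i l).
Proof.
move=> Fk; pose G l := \sum_(i | P i) F i l.
rewrite -/G; have -> : G = (fun l => \sum_(i <- index_enum I | P i) F i l) by [].
elim: (index_enum I) => [|i r IH].
  by apply: mO_ext (mO0 _) => l; rewrite big_nil.
have [Pi|nPi] := boolP (P i).
  by apply: mO_ext (mOD (Fk i Pi) IH) => l; rewrite big_cons Pi.
by apply: mO_ext IH => l; rewrite big_cons (negPf nPi).
Qed.

End BigO.

(** * Amplitudes along the two chains, by iteration of a contracting map *)

Section Dressing.
Variables (R : realType) (n : nat) (g : bool -> nat -> R) (q : R).
Hypothesis n_gt0 : (0 < n)%N.

(* A pair (xi, w) encodes x_k = (-l)^k xi_k and z = l^2 w, the boolean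
   distinguishing the two chains; q is the compression of Q_0 to the ground
   space, and the resulting energy is f = - (1 + q z). *)
Definition amplitudes := ((bool -> nat -> R -> R) * (R -> R))%type.

(** Cancelling the k-th chain vector in (H - f) X and dividing by (-l)^k gives xi_k = xi_(k-1) + l^2
    (g_k xi_(k+1) - q w xi_k), with xi_0 = 1 + l^2 w and xi_n = 0. The update takes the new value at
    k - 1 and the new shift [w'] at 0, and old values elsewhere. *)
Fixpoint dress_chain (w w' : R -> R) (xi : bool -> nat -> R -> R)
    (b : bool) (k : nat) (l : R) : R :=
  if k is k'.+1 then
    if (k < n)%N then
      dress_chain w w' xi b k' l
      + l ^+ 2 * (g b k * xi b k.+1 l - q * w l * xi b k l)
    else 0
  else 1 + l ^+ 2 * w' l.

(** This is the same cancellation for the vector Q_0 Gamma0, divided by l^2. *)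
Definition dress_shift (u : amplitudes) (l : R) : R :=
  g true 0 * u.1 true 1%N l + g false 0 * u.1 false 1%N l
  - q * (l ^+ 2 * (u.2 l * u.2 l)).

Definition dress_step (u : amplitudes) : amplitudes :=
  (dress_chain u.2 (dress_shift u) u.1, dress_shift u).

Definition dress_init : amplitudes :=
  (fun _ k _ => if (k < n)%N then 1 else 0, fun=> 0).

Definition dress_bounded (u : amplitudes) :=
  (forall b k, sO 0 (u.1 b k)) /\ sO 0 u.2.

(* The chains must agree to one order more than the shifts, which only enter the
   recursion through l^2; each step then gains one order. *)
Definition dress_close N (u v : amplitudes) :=
  (forall b k, sO N.+1 (fun l => u.1 b k l - v.1 b k l)) /\
  sO N (fun l => u.2 l - v.2 l).

Lemma dress_chain_ge w w' xi b k l : (n <= k)%N -> dress_chain w w' xi b k l = 0.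
Proof. by case: k => [|k] nk /=; [lia|rewrite ltnNge nk]. Qed.

Lemma dress_shift_bounded u : dress_bounded u -> sO 0 (dress_shift u).
Proof.
move=> [xiO wO]; apply: sOB; first by apply: sOD; apply: sOZ.
apply: sOZ; apply: (sOM (a := 0) (b := 0)) => //.
  by apply: sO_le (sO_pow _ 2).
exact: (sOM (a := 0) (b := 0)).
Qed.

(** Along a chain only terms of order l^2 are added to the starting value 1. The leading coefficient
    1 at the last site later fixes the constant in front of the target. *)
Lemma dress_step_lead u b k : dress_bounded u -> (k < n)%N ->
  sO 1 (fun l => (dress_step u).1 b k l - 1).
Proof.
move=> bu; have wO := dress_shift_bounded bu; case: bu => [xiO uO].
elim: k => [|k IH] kn.
  apply: (@sO_ext _ _ (fun l => l ^+ 2 * dress_shift u l)) => [l|].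
    by rewrite /=; ring.
  exact: sOM (sO_pow _ 2) wO.
apply: (@sO_ext _ _ (fun l => ((dress_step u).1 b k l - 1) +
   l ^+ 2 * (g b k.+1 * u.1 b k.+2 l - q * (u.2 l * u.1 b k.+1 l)))) => [l|].
  by rewrite /= kn; ring.
apply: sOD; first exact/IH/ltnW.
apply: (sOM (a := 2) (b := 0)) => //; first exact: sO_pow.
by apply: sOB; apply: sOZ => //; apply: (sOM (a := 0) (b := 0)).
Qed.

Lemma dress_step_bounded u : dress_bounded u -> dress_bounded (dress_step u).
Proof.
move=> bu; split=> [b k|]; last exact: dress_shift_bounded.
have [kn|nk] := ltnP k n; last first.
  by apply: sO_ext (sO0 _ 0) => l; rewrite /= dress_chain_ge.
apply: (@sO_ext _ _ (fun l => ((dress_step u).1 b k l - 1) + 1)) => [l|].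
  by rewrite subrK.
by apply: sOD (sO_cst 1); apply: sO_le (dress_step_lead b bu kn).
Qed.

(** By induction on the site: the value at k - 1 is covered by the induction hypothesis, and every
    other difference carries a factor l^2, which turns order N into N + 2. In the shift the
    amplitudes have no such factor, hence the extra order asked of them. *)
Lemma dress_step_close N u v : dress_bounded u -> dress_bounded v ->
  dress_close N u v -> dress_close N.+1 (dress_step u) (dress_step v).
Proof.
move=> [xu wu] [xv wv] [xuv wuv].
have shiftO : sO N.+1 (fun l => dress_shift u l - dress_shift v l).
  apply: (@sO_ext _ _ (fun l =>
    g true 0 * (u.1 true 1%N l - v.1 true 1%N l) +
    g false 0 * (u.1 false 1%N l - v.1 false 1%N l) -
    q * (l ^+ 2 * ((u.2 l - v.2 l) * (u.2 l + v.2 l))))) => [l|].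
    by rewrite /dress_shift; ring.
  apply: sOB; first by apply: sOD; apply: sOZ; exact: xuv.
  apply: sOZ; apply: (sOM (a := 2) (b := N)); first lia.
    exact: sO_pow.
  by apply: (sOM (a := N) (b := 0)); rewrite ?addn0 //; exact: sOD.
split=> // b; elim=> [|k IH].
  apply: (@sO_ext _ _ (fun l => l ^+ 2 * (dress_shift u l - dress_shift v l))).
    by move=> l /=; ring.
  by apply: (sOM (a := 2) (b := N.+1)) => //; exact: sO_pow.
case: (ltnP k.+1 n) => kn; last first.
  by apply: sO_ext (sO0 _ _) => l /=; rewrite ltnNge kn subr0.
apply: (@sO_ext _ _ (fun l =>
  ((dress_step u).1 b k l - (dress_step v).1 b k l) +
  l ^+ 2 * (g b k.+1 * (u.1 b k.+2 l - v.1 b k.+2 l)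
    - q * ((u.2 l - v.2 l) * u.1 b k.+1 l
           + v.2 l * (u.1 b k.+1 l - v.1 b k.+1 l))))) => [l|].
  by rewrite /= kn; ring.
apply: sOD => //; apply: (sOM (a := 2) (b := N)) => //; first exact: sO_pow.
apply: sOB; apply: sOZ; first by apply: sO_le (xuv _ _).
apply: sOD; first by apply: (sOM (a := N) (b := 0)); rewrite ?addn0.
by apply: (sOM (a := 0) (b := N)) => //; apply: sO_le (xuv _ _).
Qed.

Lemma dress_init_bounded : dress_bounded dress_init.
Proof.
split=> [b k|]; last exact: sO_cst.
exact: sO_cst.
Qed.

Lemma iter_dress_bounded N : dress_bounded (iter N dress_step dress_init).
Proof.
by elim: N => [|N IH] /=; [exact: dress_init_bounded|exact: dress_step_bounded].
Qed.

Lemma iter_dress_close N :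
  dress_close N (iter N dress_step dress_init)
                (iter N.+1 dress_step dress_init).
Proof.
elim: N => [|N IH]; last first.
  by apply: dress_step_close IH; exact: iter_dress_bounded.
have ib := dress_init_bounded; split=> [b k|]; last first.
  by apply: sOB; [case: ib|exact: dress_shift_bounded].
have [kn|nk] := ltnP k n.
  apply: sO_ext (sON (dress_step_lead b ib kn)) => l.
  by rewrite /= kn opprB.
by apply: sO_ext (sO0 _ _) => l; rewrite /= dress_chain_ge // ltnNge nk subr0.
Qed.

(** Finitely many iterations replace a limit: the last iterate agrees with its image to the required
    order. The conditions at sites 0 and n hold exactly, since every image of [dress_step] satisfies
    them. *)
Lemma dressed_amplitudes N : exists (xi : bool -> nat -> R -> R) (w : R -> R),
  [/\ forall b l, xi b 0 l = 1 + l ^+ 2 * w l,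
      forall b l, xi b n l = 0,
      forall b k, (k < n)%N -> sO 1 (fun l => xi b k l - 1),
      forall b k, (k.+1 < n)%N -> sO N (fun l => xi b k.+1 l - xi b k l
         - l ^+ 2 * (g b k.+1 * xi b k.+2 l - q * w l * xi b k.+1 l)) &
      sO 0 w /\
      sO N (fun l => w l - (g true 0 * xi true 1%N l + g false 0 * xi false 1%N l
         - q * (l ^+ 2 * (w l * w l))))].
Proof.
pose u := iter N.+1 dress_step dress_init.
have uE : u = dress_step (iter N dress_step dress_init) by [].
have bu : dress_bounded u := iter_dress_bounded N.+1.
have [xO wO] : dress_close N.+1 u (dress_step u) := iter_dress_close N.+1.
clearbody u.
exists u.1, u.2; split=> //.
- by move=> b l; rewrite uE.
- by move=> b l; rewrite uE /= dress_chain_ge.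
- by move=> b k kn; rewrite uE; apply: dress_step_lead (iter_dress_bounded N) kn.
(* The image of [u] satisfies the recursion with [u] in the l^2 term, so the residual is the
   difference of the defects of [u] at two neighbouring sites. *)
- move=> b k kn; apply: (@sO_ext _ _ (fun l =>
    (u.1 b k.+1 l - (dress_step u).1 b k.+1 l)
    - (u.1 b k l - (dress_step u).1 b k l))) => [l|].
    by rewrite [(dress_step u).1 b k.+1 l]/= kn /=; ring.
  by apply: sO_le (sOB (xO b k.+1) (xO b k)); lia.
- split; first by case: bu.
  by apply: sO_le wO; lia.
Qed.

End Dressing.

(** * An approximate invariant subspace *)

Section ApproximateInvariance.
Variables (R : realType) (N m : nat).
Local Notation C := R[i].
Local Notation n := m.+1.
Variables (V P om : 'M[C]_N) (a : bool -> nat -> 'M[C]_N).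
Variables (g : bool -> nat -> R) (q : R).

(** Stepping back from the first site yields Q_0 Gamma0, here [om], and not the ground projection;
    hence the special value at 0. *)
Definition lower_site b k := if k is k'.+1 then a b k'.+1 else om.

Hypothesis Va : forall b k, (k.+1 < n)%N ->
  V *m a b k.+1 = a b k.+2 + (g b k)%:C *: lower_site b k.
Hypothesis VP : V *m P = a true 1%N + a false 1%N.
Hypothesis Vom : V *m om = a true 1%N + a false 1%N.
Hypothesis PP : P *m P = P.
Hypothesis Pom : P *m om = q%:C *: P.
Hypothesis Pa : forall b k, (k.+1 < n)%N -> P *m a b k.+1 = 0.

(** The term in [x 0] stands for V acting on site 0. Reindexing the forward and backward moves over
    the same vectors makes V tridiagonal; [x n = 0] cuts off the backward sum, and only the forward
    move onto [a b n] leaves the chain. *)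
Lemma mulmx_chain b (x : nat -> C) : x n = 0 ->
  x 0 *: a b 1%N + V *m (\sum_(k < m) x k.+1 *: a b k.+1) =
  x m *: a b n + (x 1%N * (g b 0%N)%:C) *: om
  + \sum_(k < m) (x k + (g b k.+1)%:C * x k.+2) *: a b k.+1.
Proof.
move=> xn; rewrite mulmx_sumr.
rewrite (eq_bigr (fun k : 'I_m => x k.+1 *: a b k.+2
    + (x k.+1 * (g b k)%:C) *: lower_site b k)); last first.
  by move=> k _; rewrite -scalemxAr Va ?ltnS ?ltn_ord // scalerDr scalerA.
have E1 : x 0 *: a b 1%N + \sum_(k < m) x k.+1 *: a b k.+2
    = x m *: a b n + \sum_(k < m) x k *: a b k.+1.
  rewrite -(big_ord_recl m (fun k => x k *: a b k.+1)).
  by rewrite big_ord_recr addrC.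
have E2 : \sum_(k < m) (x k.+1 * (g b k)%:C) *: lower_site b k
  = (x 1%N * (g b 0%N)%:C) *: om
    + \sum_(k < m) ((g b k.+1)%:C * x k.+2) *: a b k.+1.
  transitivity (\sum_(k < n) (x k.+1 * (g b k)%:C) *: lower_site b k).
    by rewrite big_ord_recr /= xn mul0r scale0r addr0.
  rewrite big_ord_recl /=; congr (_ + _); apply: eq_bigr => k _.
  by rewrite /bump /= add1n mulrC.
rewrite big_split /= addrA E1 E2 (eq_bigr _ (fun k _ => scalerDl _ _ _)).
by rewrite big_split /= -!addrA; congr (_ + _); rewrite addrCA.
Qed.

Definition dressed_projection (x : bool -> nat -> C) (z : C) : 'M[C]_N :=
  P + z *: om + (\sum_(k < m) x true k.+1 *: a true k.+1
                 + \sum_(k < m) x false k.+1 *: a false k.+1).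

(** The choice of f cancels the coefficient - 1 - z q - f of [P]. As V sends both [P] and [om] to
    the two first chain vectors, the site 0 part feeds each chain with 1 + z, which is [x b 0]. *)
Lemma dressed_projection_residual (x : bool -> nat -> C) (l z f : C) :
    (forall b, x b 0 = 1 + z) -> (forall b, x b n = 0) ->
    f = - (1 + z * q%:C) ->
  (- P + l *: V - f%:M) *m dressed_projection x z =
    l *: (x true m *: a true n + x false m *: a false n)
  + (l * (x true 1%N * (g true 0%N)%:C + x false 1%N * (g false 0%N)%:C) - f * z)
       *: om
  + (\sum_(k < m) (l * (x true k + (g true k.+1)%:C * x true k.+2)
        - f * x true k.+1) *: a true k.+1
   + \sum_(k < m) (l * (x false k + (g false k.+1)%:C * x false k.+2)
        - f * x false k.+1) *: a false k.+1).
Proof.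
move=> x0 xn fE; pose S b := \sum_(k < m) x b k.+1 *: a b k.+1.
have PS b : P *m S b = 0.
  rewrite mulmx_sumr big1 // => k _.
  by rewrite -scalemxAr Pa ?scaler0 // ltnS ltn_ord.
have VS b : V *m S b = x b m *: a b n + (x b 1%N * (g b 0%N)%:C) *: om
  + \sum_(k < m) (x b k + (g b k.+1)%:C * x b k.+2) *: a b k.+1
  - (1 + z) *: a b 1%N.
  by rewrite -(mulmx_chain b (xn b)) x0 addrAC subrr add0r.
have split_sum b : \sum_(k < m) (l * (x b k + (g b k.+1)%:C * x b k.+2)
        - f * x b k.+1) *: a b k.+1
  = l *: \sum_(k < m) (x b k + (g b k.+1)%:C * x b k.+2) *: a b k.+1 - f *: S b.
  rewrite !scaler_sumr -sumrB; apply: eq_bigr => k _.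
  by rewrite !scalerA scalerBl.
rewrite !split_sum /dressed_projection -!/(S _) !mulmxDl mulNmx -scalemxAl.
rewrite mulNmx mul_scalar_mx !mulmxDr -!scalemxAr PP Pom !PS !VS VP Vom.
set T1 := \sum_(k < m) _; set T2 := \sum_(k < m) _.
move: (S true) (S false) T1 T2 => S1 S2 T1 T2; rewrite {}fE.
apply/matrixP => i j; rewrite !mxE; ring.
Qed.

Lemma approximate_invariance : exists (f : R -> R) (X : R -> 'M[C]_N),
  mO 1 (fun l => X l - P) /\
  mO n.+1 (fun l => (- P + l%:C *: V - (f l)%:C%:M) *m X l
     - ((-1) ^+ m * l%:C ^+ n) *: (a true n + a false n)).
Proof.
have [xi [w [xi0 xin xi1 xiO [wO wres]]]] :=
  @dressed_amplitudes R n g q (ltn0Sn m) n.+1.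
pose x b k l := (- l) ^+ k * xi b k l.
pose z l := l ^+ 2 * w l.
pose f l := - (1 + z l * q).
exists f, (fun l => dressed_projection (fun b k => (x b k l)%:C) (z l)%:C).
have Npow k : sO k (fun l : R => (- l) ^+ k).
  by exists 1 => l /andP[l0 _]; rewrite normrX normrN mul1r ger0_norm.
split.
  pose S b l := \sum_(k < m) (x b k.+1 l)%:C *: a b k.+1.
  apply: (@mO_ext _ _ _ _ (fun l => (z l)%:C *: om + (S true l + S false l))).
    move=> l; rewrite /dressed_projection -/(S true l) -/(S false l).
    by rewrite -[P + _ + _]addrA [RHS]addrAC subrr add0r.
  have SO b : mO 1 (S b).
    apply: mO_sum => k _; apply: mOZ; apply: (sOM (a := 1) (b := 0)) => //.
      exact: sO_le (Npow k.+1).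
    have [kn|nk] := ltnP k.+1 n; last first.
      apply: sO_ext (sO0 _ _) => l.
      by have -> : k.+1 = n; [move: nk (ltn_ord k); lia|rewrite xin].
    apply: (@sO_ext _ _ (fun l => (xi b k.+1 l - 1) + 1)) => [l|].
      by rewrite subrK.
    by apply: sOD (sO_cst 1); exact: sO_le (xi1 _ _ kn).
  apply: mOD; last exact: mOD.
  by apply: mOZ; apply: (sOM (a := 2) (b := 0)) => //; exact: sO_pow.
pose c b k l := l * (x b k l + g b k.+1 * x b k.+2 l) - f l * x b k.+1 l.
pose S b l := \sum_(k < m) (c b k l)%:C *: a b k.+1.
pose r l := l * (x true 1%N l * g true 0%N + x false 1%N l * g false 0%N) - f l * z l.
(* Here m = n - 1, so l x_m = l (-l)^m xi_m has the leading part (-1)^m l^n that is subtracted; what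
   is left contains xi_m - 1 and gains one order. *)
pose t b l := l * (- l) ^+ m * (xi b m l - 1).
apply: (@mO_ext _ _ _ _ (fun l => (t true l)%:C *: a true n
  + (t false l)%:C *: a false n + (r l)%:C *: om + (S true l + S false l))).
  move=> l; rewrite (@dressed_projection_residual _ _ _ (f l)%:C); last 3 first.
  - by move=> b; rewrite /x xi0 /z expr0 mul1r rmorphD.
  - by move=> b; rewrite /x xin mulr0.
  - by rewrite /f rmorphN rmorphD rmorphM.
  have SE b : \sum_(k < m) (l%:C * ((x b k l)%:C + (g b k.+1)%:C * (x b k.+2 l)%:C)
        - (f l)%:C * (x b k.+1 l)%:C) *: a b k.+1 = S b l.
    by apply: eq_bigr => k _; rewrite /c !(rmorphD, rmorphM, rmorphN).
  rewrite !SE [RHS]addrAC; congr (_ + _); rewrite [RHS]addrAC; congr (_ + _); last first.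
    by rewrite /r !(rmorphD, rmorphM, rmorphN).
  have tE b : (t b l)%:C = l%:C * (x b m l)%:C - (-1) ^+ m * l%:C ^+ n.
    have -> : (-1 : C) ^+ m = ((-1) ^+ m)%:C by rewrite rmorphXn rmorphN1.
    rewrite -rmorphXn -!rmorphM -rmorphB; congr (_%:C).
    by rewrite /t /x exprNn exprS; ring.
  by rewrite !tE; apply/matrixP => i j; rewrite !mxE; ring.
have tO b : sO n.+1 (t b).
  apply: (sOM (a := n) (b := 1)); [lia| |exact: xi1].
  by apply: (sOM (a := 1) (b := m)) => //; exact: sO_ext (sO_pow R 1).
have rO : sO n.+1 r.
  apply: (@sO_ext _ _ (fun l => l ^+ 2 * (w l
    - (g true 0 * xi true 1%N l + g false 0 * xi false 1%N l
       - q * (l ^+ 2 * (w l * w l)))))) => [l|].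
    by rewrite /r /x /f /z expr1; ring.
  by apply: (sOM (a := 2) (b := n.+1)); [lia|exact: sO_pow|].
have SO b : mO n.+1 (S b).
  apply: mO_sum => k _; apply: mOZ; have kn : (k.+1 < n)%N by rewrite ltnS ltn_ord.
  apply: (@sO_ext _ _ (fun l => (- l) ^+ k.+1 * (xi b k.+1 l - xi b k l
         - l ^+ 2 * (g b k.+1 * xi b k.+2 l - q * w l * xi b k.+1 l)))) => [l|].
    by rewrite /c /x /f /z !exprS; ring.
  by apply: (sOM (a := k.+1) (b := n.+1)); [lia|exact: Npow|exact: xiO].
apply: mOD; last exact: mOD.
by apply: mOD; [apply: mOD|]; exact: mOZ.
Qed.

End ApproximateInvariance.

(** * Perturbation of the ground space *)

Section Spectrum.
Variable R : realType.
Local Notation C := R[i].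
Local Notation normc := (@Normc.normc R).

(** In a rank factorization P = c r, the factor c has a left inverse and r a right inverse.
    Cancelling them in P P = P gives r c = 1, and c r and r c have the same trace. *)
Lemma mxtrace_idempotent (F : fieldType) N (P : 'M[F]_N) :
  P *m P = P -> \tr P = (\rank P)%:R.
Proof.
move=> PP; have [B AB] := row_freeP (row_base_free P).
have [A BA] := row_fullP (col_base_full P).
move: (row_base P) (col_base P) (mulmx_base P) AB BA => r c cr AB BA.
suff E : r *m c = 1%:M.
  by rewrite -[in LHS]cr mxtrace_mulC E mxtrace1.
have := PP; rewrite -[X in X = _ -> _]/(P *m P) -{1 2 3}cr => /(congr1 (mulmx A)).
rewrite !mulmxA BA mul1mx => /(congr1 (mulmx^~ B)).
by rewrite -!mulmxA AB !mulmx1.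
Qed.

(** Every eigenvalue of - P satisfies x^2 = - x, and -1 occurs since P is nonzero, so it is the
    smallest. Its eigenspace is the kernel of the idempotent 1 - P, whose rank is a trace. *)
Lemma ground_space_dim_projection N (P : 'M[C]_N) d :
  P *m P = P -> P <> 0 -> ground_space_dim (- P) d -> d = \rank P.
Proof.
move=> PP P0 [E0 [evE0 minE0 ->]].
have evN1 : eigenvalue (- P) (-1).
  have [i Pi] : exists i, row i P != 0.
    apply/existsP; rewrite -negb_forall; apply: contra_notN P0 => /forallP P0.
    by apply/row_matrixP => i; rewrite row0; apply/eqP.
  apply/eigenvalueP; exists (row i P) => //.
  by rewrite mulmxN -row_mul PP scaleN1r.
have E01 : E0 = -1.
  have /eigenvalueP[v vE v0] := evE0; move: vE; rewrite mulmxN => vE.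
  have vE2 : E0 ^+ 2 *: v = - E0 *: v.
    have vP : v *m P = - E0 *: v by rewrite scaleNr -vE opprK.
    have := congr1 (mulmx^~ P) vP.
    by rewrite -mulmxA PP -scalemxAl vP scalerA mulrNN expr2 => <-.
  have /eqP := vE2; rewrite -subr_eq0 -scalerBl scaler_eq0 (negPf v0) orbF.
  rewrite opprK expr2 -[X in _ + X]mulr1 -mulrDr mulf_eq0 => /orP[/eqP E00|].
    by have := minE0 _ evN1; rewrite E00 ler0N1.
  by rewrite addr_eq0 => /eqP.
rewrite E01 /eigenspace mxrank_ker; set Q := _ - _.
have QE : Q = 1%:M - P by rewrite /Q raddfN opprK addrC.
have QQ : Q *m Q = Q.
  by rewrite QE mulmxBl mul1mx mulmxBr mulmx1 PP subrr subr0.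
have /eqP := mxtrace_idempotent QQ.
rewrite {1}QE raddfB /= mxtrace1 mxtrace_idempotent // subr_eq -natrD eqr_nat.
by move=> /eqP {1}->; rewrite addKn.
Qed.

Lemma sorted_spectrumE N (H : 'M[C]_N) (s : seq R) : sorted_spectrum H s ->
  [/\ size s = N, (\sum_(x <- s) x)%:C = \tr H &
      forall x, x \in s -> eigenvalue H x%:C].
Proof.
move=> [_ chH].
have chH' : char_poly H = \prod_(x <- [seq x%:C | x <- s]) ('X - x%:P).
  by rewrite big_map.
have sz : size s = N.
  have := size_char_poly H.
  by rewrite chH' size_prod_XsubC size_map => -[].
split=> // [|x xs]; last first.
  rewrite eigenvalue_root_char chH' root_prod_XsubC.
  by apply/mapP; exists x.
have [N0|N_gt0] := posnP N.
  rewrite (size0nil (etrans sz N0)) big_nil /mxtrace big1 // => i _.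
  by have := ltn_ord i; rewrite {2}N0.
apply: oppr_inj; rewrite -char_poly_trace // chH'.
have szs : size [seq x%:C | x <- s] = N by rewrite size_map.
rewrite -[X in _`_X.-1]szs coefPn_prod_XsubC ?szs -?lt0n //.
by rewrite big_map rmorph_sum.
Qed.

(** One of x and x + 1 has modulus at least 1/2, so the other has modulus at most 2 c; the threshold
    -1/2 decides which. *)
Lemma near_spectrum (x c : R) : `|x * (x + 1)| <= c ->
  `|x - (if x < - 2^-1 then -1 else 0)| <= 2 * c.
Proof.
move=> xc; have c0 : 0 <= c := le_trans (normr_ge0 _) xc.
move: xc; rewrite normrM; case: ltP => xh xc.
  have h : 2^-1 <= `|x| by rewrite ltr0_norm; lra.
  rewrite opprK; have := normr_ge0 (x + 1); nra.
have h : 2^-1 <= `|x + 1| by rewrite ger0_norm; lra.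
rewrite subr0; have := normr_ge0 x; nra.
Qed.

Lemma sum_near_spectrum (s : seq R) (c : R) :
  (forall x, x \in s -> `|x * (x + 1)| <= c) ->
  `|\sum_(x <- s) x + (count (< - 2^-1) s)%:R| <= (size s)%:R * (2 * c).
Proof.
elim: s => [|x s IH] sc; first by rewrite big_nil add0r normr0 mul0r.
rewrite big_cons /= natrD -[(size s).+1%:R]natr1 mulrDl [1 * _]mul1r.
have /IH IH' : forall y, y \in s -> `|y * (y + 1)| <= c.
  by move=> y ys; apply: sc; rewrite in_cons ys orbT.
have := near_spectrum (sc x (mem_head _ _)).
move=> uc; have {uc}uc := lerD IH' uc. apply: (le_trans _ uc).
apply: le_trans (ler_normD _ _); rewrite le_eqVlt; apply/orP; left.
by apply/eqP; congr `|_|; case: (x < _) => /=; ring.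
Qed.

(* Each x is close to -1 or to 0, so the sum counts those close to -1. *)
Lemma low_spectrum (s : seq R) (c e : R) d : sorted <=%R s ->
  (forall x, x \in s -> `|x * (x + 1)| <= c) ->
  `|\sum_(x <- s) x + d%:R| <= e -> (size s)%:R * (2 * c) + e < 1 ->
  forall i, (i < d)%N -> `|s`_i + 1| <= 2 * c.
Proof.
move=> srt sc sd small i id.
(* Both are natural numbers, and they differ by less than 1. *)
have cnt : count (< - 2^-1) s = d.
  have := le_trans (sum_near_spectrum sc) (lexx _).
  move: sd; rewrite !ler_norml => /andP[s1 s2] /andP[s3 s4].
  apply/eqP; rewrite eqn_leq; apply/andP.
  by split; rewrite -ltnS -(ltr_nat R) -[X in _ < X]natr1; lra.
have isz : (i < size s)%N.
  by apply: leq_trans id _; rewrite -cnt; exact: count_size.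
suff sx : s`_i < - 2^-1.
  have := near_spectrum (sc _ (mem_nth 0 isz)).
  by rewrite sx opprK.
(* Were s_i at least -1/2, all later entries would be too, leaving at most i < d entries below the
   threshold. *)
rewrite ltNge; apply/negP => sx; move: id; rewrite -cnt -(cat_take_drop i s).
rewrite count_cat [X in (_ + X)%N](_ : _ = 0%N) ?addn0.
  rewrite ltnNge; move/negP; apply.
  by apply: leq_trans (count_size _ _) _; rewrite size_take isz.
apply/eqP; rewrite -leqn0 leqNgt -has_count; apply/hasPn => x.
have := drop_sorted i srt; rewrite (drop_nth 0 isz) /= => pth.
rewrite in_cons => /predU1P[-> //|xs]; first by rewrite -leNgt.
rewrite /= -leNgt (le_trans sx) //.
by have /allP := order_path_min le_trans pth; apply.
Qed.

End Spectrum.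

(** * Rules for adjoints *)

Section Adjoint.
Variable R : realType.
Local Notation C := R[i].

Lemma adjM p q r (A : 'M[C]_(p, q)) (B : 'M[C]_(q, r)) :
  (A *m B)^t* = B^t* *m A^t*.
Proof. by rewrite trmx_mul map_mxM. Qed.

Lemma adjD p q (A B : 'M[C]_(p, q)) : (A + B)^t* = A^t* + B^t*.
Proof. by rewrite raddfD map_mxD. Qed.

Lemma adjN p q (A : 'M[C]_(p, q)) : (- A)^t* = - A^t*.
Proof. by rewrite raddfN map_mxN. Qed.

Lemma adjZ p q (c : C) (A : 'M[C]_(p, q)) : (c *: A)^t* = (c^* )%R *: A^t*.
Proof. by apply/matrixP => i j; rewrite !mxE rmorphM. Qed.

Lemma adjZr p q (c : R) (A : 'M[C]_(p, q)) : (c%:C *: A)^t* = c%:C *: A^t*.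
Proof. by rewrite adjZ; congr (_ *: _); exact: conjc_real. Qed.

Lemma adj_sum p q (I : finType) (F : I -> 'M[C]_(p, q)) :
  (\sum_i F i)^t* = \sum_i (F i)^t*.
Proof. by rewrite !raddf_sum. Qed.

End Adjoint.

(** * Norms of projections, and the low-energy projection *)

Section Projections.
Variable R : realType.
Local Notation C := R[i].
Local Notation normc := (@Normc.normc R).

(** Each entry of B is bounded by the common Frobenius norm, which is at most the l1 norm of A. *)
Lemma nrm_frobenius N (A B : 'M[C]_N) :
  \tr (A *m A^t* ) = \tr (B *m B^t* ) -> nrm B <= N%:R * (N%:R * nrm A).
Proof.
rewrite !mxtrace_mul_adj => /complexI AB; apply: nrm_entry_le => i j.
rewrite -(ler_pXn2r (n := 2)) ?nnegrE ?normc_ge0 ?nrm_ge0 //.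
apply: (@le_trans _ _ (\sum_i \sum_j normc (B i j) ^+ 2)).
  rewrite (bigD1 i) //= (bigD1 j) //= -addrA lerDl addr_ge0 //.
    by apply: sumr_ge0 => *; exact: sqr_ge0.
  by do 2!apply: sumr_ge0 => *; exact: sqr_ge0.
rewrite -AB expr2 mulr_suml ler_sum // => k _; rewrite mulr_suml ler_sum // => r _.
by rewrite expr2 ler_wpM2l ?normc_ge0 // le_entry_nrm.
Qed.

(** The trace of P = P P^* is the sum of the squared moduli of its entries, so each modulus is at
    most sqrt k <= 1 + k. *)
Lemma nrm_projection N (P : 'M[C]_N) k : orthogonal_projection P ->
  \tr P = k%:R -> nrm P <= N%:R * (N%:R * (1 + k%:R)).
Proof.
move=> [Pa PP] trP; apply: nrm_entry_le => i j.
have /complexI sumE : (k%:R : R)%:C = (\sum_i \sum_j normc (P i j) ^+ 2)%:C.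
  by rewrite -mxtrace_mul_adj Pa PP trP rmorph_nat.
have Pij : normc (P i j) ^+ 2 <= k%:R.
  rewrite sumE (bigD1 i) //= (bigD1 j) //= -addrA lerDl addr_ge0 //.
    by apply: sumr_ge0 => *; exact: sqr_ge0.
  by do 2!apply: sumr_ge0 => *; exact: sqr_ge0.
have := normc_ge0 (P i j); have : 0 <= k%:R :> R by []; nra.
Qed.

(* Equal traces give (1 - P) Q and (1 - Q) P the same Frobenius norm. *)
Lemma nrm_projectionB N (P Q : 'M[C]_N) : orthogonal_projection P ->
  orthogonal_projection Q -> \tr P = \tr Q ->
  nrm (Q - P) <= (1 + N%:R * N%:R) * nrm (Q - P *m Q).
Proof.
move=> [Pa PP] [Qa QQ] trPQ.
have trQ : \tr ((Q - P *m Q)^t* *m (Q - P *m Q)) = \tr Q - \tr (P *m Q).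
  rewrite adjD adjN adjM Pa Qa mulmxBl !mulmxBr QQ !mulmxA.
  rewrite -(mulmxA Q P P) PP subrr subr0 raddfB /=.
  by rewrite -mulmxA mxtrace_mulC -mulmxA QQ.
have trP : \tr ((P - Q *m P)^t* *m (P - Q *m P)) = \tr P - \tr (Q *m P).
  rewrite adjD adjN adjM Pa Qa mulmxBl !mulmxBr PP !mulmxA.
  rewrite -(mulmxA P Q Q) QQ subrr subr0 raddfB /=.
  by rewrite -mulmxA mxtrace_mulC -mulmxA PP.
have /nrm_frobenius : \tr ((Q - P *m Q) *m (Q - P *m Q)^t* )
    = \tr ((P - Q *m P) *m (P - Q *m P)^t* ).
  rewrite [LHS]mxtrace_mulC trQ [RHS]mxtrace_mulC trP trPQ; congr (_ - _).
  exact: mxtrace_mulC.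
rewrite -(nrm_adj (P - _)) adjD adjN adjM Pa Qa => le1.
have -> : Q - P = (Q - P *m Q) - (P - P *m Q) by rewrite opprB addrA subrK.
rewrite (le_trans (nrmB _ _)) // mulrDl mul1r lerD2l.
by rewrite -mulrA.
Qed.

Variables (N d : nat) (H : 'M[C]_N) (E : 'I_d -> R) (phi : 'I_d -> 'cV[C]_N).
Hypothesis Ha : H^t* = H.
Hypothesis ortho : orthonormal_family phi.
Hypothesis eig : forall i, H *m phi i = (E i)%:C *: phi i.
Local Notation Pi := (low_projection phi).

Lemma low_projection_proj : orthogonal_projection Pi.
Proof.
split; rewrite /hermitian_op /low_projection.
  by rewrite adj_sum; apply: eq_bigr => i _; rewrite adjM trmxCK.
rewrite mulmx_suml; apply: eq_bigr => i _; rewrite mulmx_sumr (bigD1 i) //=.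
rewrite big1 ?addr0 => [|j ji]; rewrite mulmxA -(mulmxA (phi i)) ortho.
  by rewrite eqxx mulmx1.
by rewrite eq_sym (negPf ji) -scalemx1 scale0r mulmx0 mul0mx.
Qed.

Lemma low_projection_trace : \tr Pi = d%:R.
Proof.
rewrite raddf_sum /= (eq_bigr (fun=> 1)) => [|i _].
  by rewrite sumr_const card_ord.
by rewrite mxtrace_mulC ortho eqxx mxtrace1.
Qed.

Lemma ket_projection i : orthogonal_projection (phi i *m (phi i)^t* ).
Proof.
split; first by rewrite /hermitian_op adjM trmxCK.
by rewrite mulmxA -(mulmxA (phi i)) ortho eqxx mulmx1.
Qed.

Lemma mulmx_low_projection : H *m Pi = Heff E phi.
Proof.
by rewrite mulmx_sumr; apply: eq_bigr => i _; rewrite mulmxA eig scalemxAl.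
Qed.

Lemma low_projection_mulmx : Pi *m H = Heff E phi.
Proof.
have [Pia _] := low_projection_proj.
rewrite -[LHS]trmxCK adjM Pia Ha mulmx_low_projection adj_sum.
by apply: eq_bigr => i _; rewrite adjZr adjM trmxCK.
Qed.

Lemma nrm_ket i : nrm (phi i *m (phi i)^t* ) <= N%:R * (N%:R * 2).
Proof.
rewrite (le_trans (nrm_projection (k := 1) (ket_projection i) _)) //.
by rewrite mxtrace_mulC ortho eqxx mxtrace1.
Qed.

Lemma nrm_Heff b : (forall i, `|E i| <= b) ->
  nrm (Heff E phi) <= d%:R * (b * (N%:R * (N%:R * 2))).
Proof.
move=> Eb; apply: le_trans (nrm_sum _) _.
apply: (@le_trans _ _ (\sum_(i < d) b * (N%:R * (N%:R * 2)))).
  apply: ler_sum => i _; rewrite nrmZ normcC ler_pM ?nrm_ge0 ?Eb ?nrm_ket //.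
by rewrite sumr_const card_ord [d%:R * _]mulr_natl.
Qed.

End Projections.

(** * Low energies and low-energy projection of - P + l V *)

Section Perturbation.
Variable R : realType.
Local Notation C := R[i].
Local Notation normc := (@Normc.normc R).

Lemma eigenvalue_nrm N (A : 'M[C]_N) (x : C) : eigenvalue A x -> normc x <= nrm A.
Proof.
case/eigenvalueP => v vA v0.
have v_gt0 : 0 < nrm v.
  by rewrite lt_neqAle nrm_ge0 andbT eq_sym; apply: contra_neq v0 => v0;
    apply: nrm_eq0; rewrite v0.
by rewrite -(ler_pM2r v_gt0) -nrmZ -vA mulrC nrmM.
Qed.

Lemma eigenvalue_quadratic N (A : 'M[C]_N) (x : C) :
  eigenvalue A x -> eigenvalue (A *m A + A) (x * (x + 1)).
Proof.
case/eigenvalueP => v vA v0; apply/eigenvalueP; exists v => //.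
by rewrite mulmxDr mulmxA vA -scalemxAl vA scalerA -scalerDl mulrDr mulr1.
Qed.

Variables (N : nat) (P V : 'M[C]_N).
Hypotheses (Pproj : orthogonal_projection P) (P_neq0 : P <> 0) (Va : V^t* = V).

Definition perturbed (l : R) : 'M[C]_N := - P + l%:C *: V.

Lemma perturbed_hermitian l : (perturbed l)^t* = perturbed l.
Proof. by case: Pproj => Pa _; rewrite adjD adjN adjZr Pa Va. Qed.

Lemma ground_dimE d : ground_space_dim (- P) d -> d = \rank P.
Proof. by case: Pproj => _ PP; exact: ground_space_dim_projection. Qed.

Lemma trace_ground d : ground_space_dim (- P) d -> \tr P = d%:R.
Proof.
by move=> /ground_dimE ->; apply: mxtrace_idempotent; case: Pproj.
Qed.

(** At order zero H^2 + H is P - P = 0. Hence every eigenvalue x of H has x (x + 1) = O(l), that is,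
    lies near -1 or 0. *)
Lemma perturbed_quadratic : exists2 c, 0 <= c & forall l, 0 <= l <= 1 ->
  nrm (perturbed l *m perturbed l + perturbed l) <= c * l.
Proof.
have [Pa PP] := Pproj.
exists (nrm (V - P *m V - V *m P) + nrm (V *m V)).
  by rewrite addr_ge0 ?nrm_ge0.
move=> l /andP[l0 l1].
have -> : perturbed l *m perturbed l + perturbed l =
    l%:C *: (V - P *m V - V *m P) + (l ^+ 2)%:C *: (V *m V).
  rewrite /perturbed mulmxDl !mulmxDr !mulNmx !mulmxN opprK PP.
  rewrite -!scalemxAl -!scalemxAr scalerA -expr2 -rmorphXn.
  by apply/matrixP => i j; rewrite !mxE; ring.
rewrite (le_trans (nrmD _ _)) // !nrmZ !normcC mulrDl lerD //.
  by rewrite mulrC ger0_norm.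
rewrite mulrC ler_wpM2l ?nrm_ge0 // ger0_norm ?exprn_ge0 //.
by rewrite expr2 ler_piMr.
Qed.

(** The trace of H is - d + l tr V, so the count behind [low_spectrum] finds exactly d eigenvalues
    near -1. *)
Lemma low_energies : exists l0 K : R, [/\ 0 < l0 <= 1, 0 <= K &
  forall l, 0 <= l <= l0 -> forall d (E : 'I_d -> R) (phi : 'I_d -> 'cV[C]_N),
    ground_space_dim (- P) d -> lowest_eigensystem (perturbed l) E phi ->
  forall i, `|E i + 1| <= K * l].
Proof.
have [c c0 cH] := perturbed_quadratic.
pose t := normc (\tr V); have t0 : 0 <= t := normc_ge0 _.
(* For l <= 1 / D the total error (2 N c + t) l stays below 1, as counting requires; the summand 1
   makes this strict and gives 1 / D <= 1. *)
pose D := 1 + (N%:R * (2 * c) + t).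
have D1 : 1 <= D by rewrite lerDl addr_ge0 // mulr_ge0 // mulr_ge0.
have D0 : 0 < D := lt_le_trans ltr01 D1.
exists D^-1, (2 * c); split; first by rewrite invr_gt0 D0 invf_le1.
  by rewrite mulr_ge0.
move=> l /andP[l_ge0 lD] d E phi gd [[s spec Es] _ _] i.
have l1 : l <= 1 by rewrite (le_trans lD) // invf_le1.
have [srt _] := spec; have [sz sumE eigs] := sorted_spectrumE spec.
rewrite Es -mulrA.
apply: (@low_spectrum _ s (c * l) (t * l) d) => //.
- move=> x /eigs /eigenvalue_quadratic /eigenvalue_nrm.
  rewrite -(rmorph1 (real_complex R)) -rmorphD -rmorphM normcC => le1.
  by apply: le_trans le1 _; apply: cH; rewrite l_ge0.
- have sumV : (\sum_(x <- s) x + d%:R)%:C = l%:C * \tr V.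
    rewrite rmorphD [X in X + _]sumE mxtraceD mxtraceZ raddfN /= (trace_ground gd).
    by rewrite rmorph_nat addrC addNKr.
  by rewrite -normcC sumV Normc.normcM normcC ger0_norm // mulrC.
- rewrite sz; apply: (@lt_le_trans _ _ (D * D^-1)); last by rewrite mulfV ?gt_eqF.
  have : N%:R * (2 * c) + t < D by rewrite /D; lra.
  have X0 : 0 <= N%:R * (2 * c) + t by rewrite addr_ge0 // mulr_ge0 // mulr_ge0.
  have Di : 0 < D^-1 by rewrite invr_gt0.
  move=> XD; apply: (@le_lt_trans _ _ ((N%:R * (2 * c) + t) * D^-1)); last first.
    by rewrite ltr_pM2r.
  by rewrite (_ : _ + t * l = (N%:R * (2 * c) + t) * l) ?ler_wpM2l //; ring.
Qed.

(** From H = - P + l V follows (1 - P) Pi = (H + 1) Pi - l V Pi, where both terms are O(l) since the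
    low energies are near -1. As P and Pi have the same trace, [nrm_projectionB] extends this to Pi
    - P. *)
Lemma low_projection_near : exists l0 K : R, [/\ 0 < l0 <= 1, 0 <= K &
  forall l, 0 <= l <= l0 -> forall d (E : 'I_d -> R) (phi : 'I_d -> 'cV[C]_N),
    ground_space_dim (- P) d -> lowest_eigensystem (perturbed l) E phi ->
  nrm (low_projection phi - P) <= K * l /\ nrm (low_projection phi) <= K].
Proof.
have [l0 [K [l01 K0 EK]]] := low_energies.
have [Pa PP] := Pproj.
pose B : R := N%:R * (N%:R * (1 + (\rank P)%:R)).
pose K1 := (\rank P)%:R * (K * (N%:R * (N%:R * 2))) + nrm V * B.
pose K2 := (1 + N%:R * N%:R) * K1.
have B0 : 0 <= B by rewrite /B !mulr_ge0 // addr_ge0.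
have K10 : 0 <= K1 by rewrite /K1 !(addr_ge0, mulr_ge0, nrm_ge0).
have K20 : 0 <= K2 by rewrite mulr_ge0 // addr_ge0 // mulr_ge0.
exists l0, (K2 + B); split=> //; first by rewrite addr_ge0.
move=> l l_l0 d E phi gd low; have [spec ortho eig] := low.
have dE := ground_dimE gd.
set Pi := low_projection phi.
have PiP : orthogonal_projection Pi := low_projection_proj ortho.
have PiB : nrm Pi <= B.
  by apply: nrm_projection => //; rewrite low_projection_trace // dE.
have /andP[lge0 _] := l_l0.
split; last by rewrite (le_trans PiB) // lerDr.
apply: (@le_trans _ _ (K2 * l)); last by rewrite ler_wpM2r // lerDl.
apply: le_trans (nrm_projectionB Pproj PiP _) _.
  by rewrite (trace_ground gd) low_projection_trace.
rewrite -mulrA ler_wpM2l ?addr_ge0 ?mulr_ge0 //.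
have -> : Pi - P *m Pi = Heff (fun i => E i + 1) phi - l%:C *: (V *m Pi).
  have -> : Heff (fun i => E i + 1) phi = Heff E phi + Pi.
    rewrite /Heff -big_split; apply: eq_bigr => i _.
    by rewrite rmorphD scalerDl rmorph1 scale1r.
  rewrite -(mulmx_low_projection eig) mulmxDl mulNmx -scalemxAl.
  by rewrite -/Pi addrAC addrK addrC.
apply: le_trans (nrmB _ _) _; rewrite mulrDl lerD //.
  rewrite (_ : _ * l = d%:R * (K * l * (N%:R * (N%:R * 2)))); last first.
    by rewrite dE; ring.
  by apply: nrm_Heff => // i; apply: EK gd low i.
rewrite nrmZ normcC ger0_norm // mulrC ler_wpM2r //.
by rewrite (le_trans (nrmM _ _)) // ler_wpM2l ?nrm_ge0.
Qed.

(* With [Y = (H - f) X] and [G = (H - f) Pi], the identity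
   [Pi Y Pi = G (Pi X Pi) = G - G D], where [D = Pi - Pi X Pi] is small,
   determines [G] without inverting anything. *)
Lemma shifted_Heff_expansion (k : nat) (f : R -> R) (X : R -> 'M[C]_N)
    (e : C) (T : 'M[C]_N) :
  normc e = 1 -> mO 1 (fun l => X l - P) ->
  mO k.+1 (fun l => (perturbed l - (f l)%:C%:M) *m X l - (e * l%:C ^+ k) *: T) ->
  exists l0 K : R, 0 < l0 /\
  forall l, 0 <= l <= l0 -> forall d (E : 'I_d -> R) (phi : 'I_d -> 'cV[C]_N),
    ground_space_dim (- P) d -> lowest_eigensystem (perturbed l) E phi ->
  nrm (shifted_Heff E phi (f l) - (e * l%:C ^+ k) *: (P *m T *m P))
    <= K * l ^+ k.+1.
Proof.
move=> e1 /mO_pos[KX KX0 XO] /mO_pos[KY KY0 YO].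
have [l1 [K [/andP[l10 l11] K0 near]]] := low_projection_near.
pose KD := K * (K + KX) * K.
have KD0 : 0 <= KD by rewrite /KD !mulr_ge0 // addr_ge0.
pose KG := 2 * (K * (KY + nrm T) * K).
have KG0 : 0 <= KG by rewrite /KG !mulr_ge0 // addr_ge0 // nrm_ge0.
(* This makes the norm of D at most 1/2, so that G D can be absorbed into the left side of G = Pi Y
   Pi + G D; the factor 2 in [KG] is the price. *)
pose l0 := Num.min l1 (2 * KD + 1)^-1.
have D1 : 0 < 2 * KD + 1 by lra.
exists l0, (K * KY * K + (K * nrm T * K + nrm P * nrm T * K) + KG * KD).
split; first by rewrite /l0 lt_min l10 invr_gt0.
move=> l /andP[lge0 ll0] d E phi gd low.
have ll1 : 0 <= l <= l1 by rewrite lge0 (le_trans ll0) // ge_min lexx.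
have l01 : 0 <= l <= 1 by case/andP: ll1 => ? ll1; rewrite lge0 (le_trans ll1).
have [PiP PiK] := near l ll1 d E phi gd low.
have [spec ortho eig] := low.
set Pi := low_projection phi in PiP PiK *.
have [_ PiPi] : orthogonal_projection Pi := low_projection_proj ortho.
set H := perturbed l; pose c := e * l%:C ^+ k.
have nc : normc c = l ^+ k.
  by rewrite Normc.normcM e1 mul1r -rmorphXn normcC ger0_norm // exprn_ge0.
pose Y := (H - (f l)%:C%:M) *m X l.
pose G := shifted_Heff E phi (f l).
pose D := Pi - Pi *m X l *m Pi.
have GPi : G = (H - (f l)%:C%:M) *m Pi.
  by rewrite mulmxBl mul_scalar_mx (mulmx_low_projection eig).
have GPi' : G = Pi *m (H - (f l)%:C%:M).
  rewrite mulmxBr mul_mx_scalar.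
  by rewrite (low_projection_mulmx (perturbed_hermitian l) ortho eig).
have GG : G *m Pi = G by rewrite GPi -mulmxA PiPi.
have PYP : Pi *m Y *m Pi = G *m (Pi *m X l *m Pi).
  by rewrite /Y !mulmxA -GPi' GG.
have GY : G = Pi *m Y *m Pi + G *m D by rewrite PYP mulmxBr GG addrC subrK.
have nY : nrm (Y - c *: T) <= KY * l ^+ k.+1 by exact: YO.
have sandwich (A : 'M[C]_N) a : nrm A <= a -> nrm (Pi *m A *m Pi) <= K * a * K.
  move=> Aa; apply: le_trans (nrmM _ _) _; rewrite ler_pM ?nrm_ge0 //.
  by apply: le_trans (nrmM _ _) _; rewrite ler_pM ?nrm_ge0.
have nD : nrm D <= KD * l.
  have -> : D = Pi *m (Pi - X l) *m Pi by rewrite mulmxBr mulmxBl !PiPi.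
  rewrite /KD mulrAC -[K * (K + KX) * l]mulrA; apply: sandwich.
  rewrite (_ : Pi - X l = (Pi - P) - (X l - P)); last by rewrite opprB addrA subrK.
  rewrite (le_trans (nrmB _ _)) // mulrDl lerD //.
  by have := XO l l01; rewrite expr1.
have KDl : KD * l <= 2^-1.
  have : (2 * KD + 1) * l <= 1.
    rewrite mulrC -ler_pdivlMr // mul1r (le_trans ll0) // ge_min lexx orbT //.
  by nra.
have lk0 : 0 <= l ^+ k by rewrite exprn_ge0.
have nY' : nrm Y <= (KY + nrm T) * l ^+ k.
  rewrite -[Y](subrK (c *: T)).
  apply: le_trans (nrmD _ _) _; rewrite mulrDl lerD //.
    apply: le_trans nY _; rewrite ler_wpM2l // exprS ler_piMl //.
    by case/andP: l01.
  by rewrite nrmZ nc mulrC.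
(* This rough bound on G, multiplied by D = O(l), puts G D at order k + 1. *)
have nG : nrm G <= KG * l ^+ k.
  have h1 : nrm G <= nrm (Pi *m Y *m Pi) + nrm G * nrm D.
    by rewrite {1}GY (le_trans (nrmD _ _)) // lerD2l nrmM.
  have h2 := sandwich _ _ nY'.
  have h3 : nrm G * nrm D <= nrm G * 2^-1.
    by rewrite ler_wpM2l ?nrm_ge0 // (le_trans nD).
  rewrite /KG; move: h1 h2 h3; rewrite !mulrA; set a := nrm G; lra.
(* Three errors of order k + 1: that of Y, that of replacing Pi by P on each side of T next to a
   factor l^k, and G D. *)
have -> : G - c *: (P *m T *m P) = Pi *m (Y - c *: T) *m Pi
  + c *: ((Pi - P) *m T *m Pi + P *m T *m (Pi - P)) + G *m D.
  rewrite {1}GY !(mulmxBr, mulmxBl) -!(scalemxAl, scalemxAr).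
  by apply/matrixP => i j; rewrite !mxE; ring.
rewrite !mulrDl; apply: le_trans (nrmD _ _) _; rewrite lerD //; last first.
  apply: le_trans (nrmM _ _) _; rewrite exprSr mulrACA.
  by rewrite ler_pM ?nrm_ge0.
apply: le_trans (nrmD _ _) _; rewrite lerD //.
  by rewrite -[K * KY * K * _]mulrAC -[K * KY * _]mulrA; exact: sandwich.
rewrite [leRHS](_ : _ =
    l ^+ k * (K * l * nrm T * K + nrm P * nrm T * (K * l))); last first.
  by rewrite exprSr; ring.
rewrite nrmZ nc ler_wpM2l // (le_trans (nrmD _ _)) // lerD //.
  do 2!(rewrite (le_trans (nrmM _ _)) // ler_pM ?nrm_ge0 //).
by rewrite (le_trans (nrmM _ _)) // ler_pM ?nrm_ge0 ?nrmM.
Qed.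

End Perturbation.

(** * The ring of hopping operators *)

Section CyclicHopping.
Variables (R : realType) (m p : nat).
Local Notation C := R[i].
Local Notation n := p.+1.
Variable M : 'I_n -> 'M[C]_m.

Local Notation site k := (inZp k : 'I_n).
Local Notation ket i := (ketbra R i (ord0 : 'I_n)).

Lemma ordS_inZp k : ordS (site k) = site k.+1.
Proof. by apply: val_inj; rewrite /= -addn1 modnDml addn1. Qed.

Lemma ord_pred_inZp k : ord_pred (site k.+1) = site k.
Proof. by rewrite -ordS_inZp ordSK. Qed.

Lemma inZp_size : site n = ord0.
Proof. by apply: val_inj; rewrite /= modnn. Qed.

Lemma inZp_ord (i : 'I_n) : site i = i.
Proof. by apply: val_inj; rewrite /= modn_small. Qed.

Lemma mulmx_adj_eq0 (A : 'M[C]_m) : A *m A^t* = 0 -> A = 0.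
Proof.
move=> A0; apply: nrm_eq0; have := @nrm_frobenius R m 0 A.
by rewrite A0 mul0mx nrm0 !mulr0; apply.
Qed.

(** Taking adjoints shows that c is its own conjugate. This makes g and q real, hence also the shift
    f. *)
Lemma hermitian_scale_real (A B : 'M[C]_m) (c : C) :
  A^t* = A -> B^t* = B -> A <> 0 -> B = c *: A -> c = (complex.Re c)%:C.
Proof.
move=> Aa Ba A0 BA; have : (c^* )%R *: A = c *: A.
  by rewrite -BA -[RHS]Ba BA adjZ Aa.
move/eqP; rewrite -subr_eq0 -scalerBl scaler_eq0 => /orP[|/eqP //].
by rewrite subr_eq0 => /eqP cc; apply/esym/RRe_real/CrealP.
Qed.

(* If one M i vanishes then so do all of them, and g = 0, Q = 0 works;
   otherwise all the proportionality constants are nonzero. *)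
Lemma cyclic_structure :
    (forall i, propto ((M i *m (M i)^t*) *m (M i *m (M i)^t*)) (M i *m (M i)^t*)) ->
    (forall i, propto (M i *m (M i)^t*) ((M (ord_pred i))^t* *m M (ord_pred i))) ->
  exists (g : 'I_n -> R) (Q : 'I_n -> 'M[C]_m), forall i,
  [/\ M i *m (M i)^t* = (g i)%:C *: Q i,
      (M i)^t* *m M i = (g i)%:C *: Q (ordS i),
      Q i *m M i = M i, M i *m Q (ordS i) = M i &
      (Q i)^t* = Q i /\ propto (Q i) (M i *m (M i)^t*)].
Proof.
move=> h2 h3'.
have h3 i : propto (M (ordS i) *m (M (ordS i))^t*) ((M i)^t* *m M i).
  by have := h3' (ordS i); rewrite ordSK.
have [/forallP Mn0|] := boolP [forall i, M i != 0]; last first.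
  rewrite negb_forall => /existsP[j]; rewrite negbK => /eqP Mj.
  (* A zero spreads around the ring: if M_i = 0, then (iii) annihilates the product of M_(i+1) with
     its adjoint, hence M_(i+1). *)
  have Mjk k : M (site (j + k)) = 0.
    elim: k => [|k IH]; first by rewrite addn0 inZp_ord.
    rewrite addnS -ordS_inZp; apply: mulmx_adj_eq0.
    by have [c ->] := h3 (site (j + k)); rewrite IH mulmx0 scaler0.
  have M0 i : M i = 0.
    rewrite -(Mjk (n - j + i)%N) addnA subnKC ?(ltnW (ltn_ord j)) //.
    by congr M; apply: val_inj; rewrite /= modnDl modn_small.
  exists (fun=> 0), (fun=> 0) => i; rewrite !M0 trmx0 map_mx0 !mulmx0 scaler0.
  by do 2!split=> //; exists 0; rewrite scaler0.
pose A i := M i *m (M i)^t*.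
have Aa i : (A i)^t* = A i by rewrite adjM trmxCK.
have A0 i : A i <> 0 by move/mulmx_adj_eq0/eqP; exact/negP/Mn0.
have [g gE] : exists g : 'I_n -> R, forall i, A i *m A i = (g i)%:C *: A i.
  have /choice[c cE] := h2; exists (fun i => complex.Re (c i)) => i.
  have AAa : (A i *m A i)^t* = A i *m A i by rewrite adjM Aa.
  by rewrite -(hermitian_scale_real (Aa i) AAa (A0 i) (cE i)); exact: cE.
have g0 i : (g i)%:C != 0.
  apply/eqP => gi; apply: (A0 i); apply: mulmx_adj_eq0.
  by rewrite Aa gE gi scale0r.
(* The product of (A - g) M with its adjoint contains (A - g) A = 0. So A / g is the projection onto
   the range of M. *)
have AM i : A i *m M i = (g i)%:C *: M i.
  apply/eqP; rewrite -subr_eq0; apply/eqP/mulmx_adj_eq0.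
  rewrite -mul_scalar_mx -mulmxBl adjM mulmxA -(mulmxA _ (M i)) -/(A i).
  by rewrite mulmxBl mul_scalar_mx gE subrr mul0mx.
have MA i : (M i)^t* *m A i = (g i)%:C *: (M i)^t*.
  by rewrite -adjZr -AM adjM Aa.
have [c cE] : exists c : 'I_n -> C, forall i, A (ordS i) = c i *: ((M i)^t* *m M i).
  by have /choice[c cE] := h3; exists c.
have BB i : (M i)^t* *m M i *m ((M i)^t* *m M i) = (g i)%:C *: ((M i)^t* *m M i).
  by rewrite !mulmxA -(mulmxA _ (M i)) MA -scalemxAl.
have c0 i : c i != 0.
  by apply/eqP => ci; apply: (A0 (ordS i)); rewrite cE ci scale0r.
(* Squaring [A (ordS i)] in two ways relates neighbouring scalars; this lets M_i^* M_i have the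
   scalar of site i and the projection of site i + 1. *)
have gc i : (g (ordS i))%:C = c i * (g i)%:C.
  have : A (ordS i) *m A (ordS i) = (c i * (g i)%:C) *: A (ordS i).
    by rewrite !cE -scalemxAl -scalemxAr BB !scalerA; congr (_ *: _); ring.
  rewrite gE => /eqP; rewrite -subr_eq0 -scalerBl scaler_eq0.
  by case/orP => [|/eqP/A0 //]; rewrite subr_eq0 => /eqP.
exists g, (fun i => (g i)%:C^-1 *: A i) => i; split.
- by rewrite scalerA mulfV // scale1r.
- rewrite cE !scalerA gc -[LHS]scale1r; congr (_ *: _).
  by field; rewrite c0 g0.
- by rewrite -scalemxAl AM scalerA mulVf // scale1r.
- rewrite -scalemxAr cE -scalemxAr mulmxA -/(A i) AM !scalerA gc.
  by rewrite -[RHS]scale1r; congr (_ *: _); field; rewrite c0 g0.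
- by split; [rewrite -fmorphV adjZr Aa|exists (g i)%:C^-1].
Qed.

Lemma ketbraM (i j k l : 'I_n) :
  ketbra R i j *m ketbra R k l = (j == k)%:R *: ketbra R i l.
Proof. by rewrite /ketbra mul_delta_mx_cond scaler_nat. Qed.

Lemma tensmxZr (A : 'M[C]_m) (c : C) (B : 'M[C]_n) : A *t (c *: B) = c *: (A *t B).
Proof. by apply/matrixP => i j; rewrite !mxE mulrCA. Qed.

Lemma tensmxZl (A : 'M[C]_m) (c : C) (B : 'M[C]_n) : (c *: A) *t B = c *: (A *t B).
Proof. by apply/matrixP => i j; rewrite !mxE mulrA. Qed.

Lemma tensmxDl (A A' : 'M[C]_m) (B : 'M[C]_n) : (A + A') *t B = A *t B + A' *t B.
Proof. by apply/matrixP => i j; rewrite !mxE mulrDl. Qed.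

Lemma adj_tens (A : 'M[C]_m) (B : 'M[C]_n) : (A *t B)^t* = A^t* *t B^t*.
Proof. by rewrite trmx_tens map_mxT. Qed.

Lemma adj_ketbra (i j : 'I_n) : (ketbra R i j)^t* = ketbra R j i.
Proof. by rewrite /ketbra trmx_delta map_delta_mx. Qed.

Lemma cyclic_V_hermitian : (cyclic_V M)^t* = cyclic_V M.
Proof.
rewrite adj_sum; apply: eq_bigr => i _.
by rewrite adjD !adj_tens !adj_ketbra trmxCK addrC.
Qed.

Lemma cyclic_V_ket (A : 'M[C]_m) i : cyclic_V M *m (A *t ket i) =
  ((M i)^t* *m A) *t ket (ordS i) + (M (ord_pred i) *m A) *t ket (ord_pred i).
Proof.
rewrite mulmx_suml (eq_bigr (fun k =>
  (k == i)%:R *: (((M k)^t* *m A) *t ket (ordS k)) +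
  (k == ord_pred i)%:R *: ((M k *m A) *t ket k))) => [|k _]; last first.
  rewrite mulmxDl !tensmx_mul !ketbraM !tensmxZr; congr (_ + _ *: _).
  by rewrite (can2_eq (@ordSK _) (@ord_predK _)).
rewrite big_split /=; congr (_ + _).
  rewrite (bigD1 i) //= eqxx scale1r big1 ?addr0 // => k /negPf ->.
  by rewrite scale0r.
rewrite (bigD1 (ord_pred i)) //= eqxx scale1r big1 ?addr0 // => k /negPf ->.
by rewrite scale0r.
Qed.

Variable Gamma0 : 'M[C]_m.

Fixpoint forward_op k : 'M[C]_m :=
  if k is k'.+1 then (M (site k'))^t* *m forward_op k' else Gamma0.

Fixpoint backward_op k : 'M[C]_m :=
  if k is k'.+1 then M (site (n - k'.+1)) *m backward_op k' else Gamma0.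

(** Reduction modulo n in [inZp] lets both walks start at site 0 and return there after n steps. *)
Definition walk (b : bool) k : 'M[C]_(m * n) :=
  if b then forward_op k *t ket (site k) else backward_op k *t ket (site (n - k)).

Lemma forward_opE k :
  forward_op k = (\big[mulmx/1%:M]_(i < k) (M (site (k - i.+1)))^t* ) *m Gamma0.
Proof.
elim: k => [|k IH] /=; first by rewrite big_ord0 mul1mx.
rewrite big_ord_recl /= subn1 /= -mulmxA IH; congr (_ *m (_ *m _)).

Qed.

Lemma backward_opE k : (k <= n)%N ->
  backward_op k = (\big[mulmx/1%:M]_(n - k <= i < n) M (site i)) *m Gamma0.
Proof.
elim: k => [|k IH] kn /=; first by rewrite subn0 big_geq // mul1mx.
rewrite big_ltn; last by rewrite subSS; apply: leq_ltn_trans (leq_subr _ _) _.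
by rewrite -mulmxA IH ?(ltnW kn) // -subSn // subSS.
Qed.

(** Once the ring is closed, the backward walk carries M_0 ... M_(n-1) Gamma0 and the forward one
    M_(n-1)^* ... M_0^* Gamma0, so the summands of the target appear swapped. *)
Lemma Htarget_walk : Gamma0 *m Gamma0 = Gamma0 ->
  (Gamma0 *t ket ord0) *m (walk true n + walk false n) *m (Gamma0 *t ket ord0)
  = Htarget Gamma0 M *t ket ord0.
Proof.
move=> GG; rewrite /walk subnn inZp_size.
have -> : site 0 = ord0 by exact: val_inj.
move: (forward_opE n) (backward_opE (leqnn n)); rewrite subnn big_mkord.
move: (forward_op n) (backward_op n) => F B FE BE.
have GA A : Gamma0 *m (A *m Gamma0) *m Gamma0 = Gamma0 *m A *m Gamma0.
  by rewrite -mulmxA -(mulmxA A) GG mulmxA.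
have kk : ket ord0 *m ket ord0 = ket ord0 by rewrite ketbraM eqxx scale1r.
suff <- : Gamma0 *m F *m Gamma0 + Gamma0 *m B *m Gamma0 = Htarget Gamma0 M.
  by rewrite mulmxDr mulmxDl !tensmx_mul !kk -tensmxDl.
rewrite [LHS]addrC FE BE !GA /Htarget; congr (_ + _); congr (_ *m _ *m _).
  by apply: eq_bigr => i _; rewrite inZp_ord.
by apply: eq_bigr => i _; rewrite -[rev_ord i]inZp_ord.
Qed.

End CyclicHopping.

(** * The expansion for the cyclic Hamiltonian *)

Section CyclicExpansion.
Variables (R : realType) (m p : nat).
Local Notation C := R[i].
Local Notation n := p.+1.
Variables (Gamma0 : 'M[C]_m) (M : 'I_n -> 'M[C]_m).
Hypothesis Gproj : orthogonal_projection Gamma0.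
Hypothesis G_neq0 : Gamma0 <> 0.
Hypothesis hii : forall i,
  propto ((M i *m (M i)^t*) *m (M i *m (M i)^t*)) (M i *m (M i)^t*).
Hypothesis hiii : forall i,
  propto (M i *m (M i)^t*) ((M (ord_pred i))^t* *m M (ord_pred i)).
Hypothesis hiv :
  propto (Gamma0 *m M ord0 *m (M ord0)^t* *m Gamma0) Gamma0.

Local Notation site k := (inZp k : 'I_n).
Local Notation ket i := (ketbra R i (ord0 : 'I_n)).
Local Notation P0 := (Gamma0 *t ket ord0).

Lemma ket0_idem : ket ord0 *m ket ord0 = ket ord0.
Proof. by rewrite ketbraM eqxx scale1r. Qed.

Lemma P0_proj : orthogonal_projection P0.
Proof.
have [Ga GG] := Gproj.
by split; rewrite /hermitian_op ?adj_tens ?adj_ketbra ?Ga ?tensmx_mul ?GG ?ket0_idem.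
Qed.

Lemma P0_neq0 : P0 <> 0.
Proof.
move=> P00; apply: G_neq0; apply/matrixP => i j.
have := congr1 (fun A : 'M_(m * n) =>
  A (mxtens_index (i, ord0)) (mxtens_index (j, ord0))) P00.
by rewrite tensmxE !mxE eqxx mulr1.
Qed.

Lemma ket0_site k : site k != ord0 -> ket ord0 *m ket (site k) = 0.
Proof. by move=> k0; rewrite ketbraM eq_sym (negPf k0) scale0r. Qed.

Lemma site_neq0 k : (0 < k < n)%N -> site k != ord0.
Proof.
case/andP => k0 kn; apply/eqP => /(congr1 val) /=.
by rewrite modn_small //; lia.
Qed.

Lemma cyclic_approximate_invariance : exists (f : R -> R) (X : R -> 'M[C]_(m * n)),
  mO 1 (fun l => X l - P0) /\
  mO n.+1 (fun l => (- P0 + l%:C *: cyclic_V M - (f l)%:C%:M) *m X l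
     - ((-1) ^+ p * l%:C ^+ n) *: (walk M Gamma0 true n + walk M Gamma0 false n)).
Proof.
have [Ga GG] := Gproj.
have [g [Q gQ]] := cyclic_structure hii hiii.
(* As Q_0 is proportional to M_0 M_0^*, (iv) says that its compression to the ground space is
   scalar. *)
have [q qE] : exists q : R, Gamma0 *m Q ord0 *m Gamma0 = q%:C *: Gamma0.
  have [_ _ _ _ [Qa [c Qc]]] := gQ ord0; have [c' c'E] := hiv.
  have E : Gamma0 *m Q ord0 *m Gamma0 = (c * c') *: Gamma0.
    by rewrite Qc -scalemxAr -scalemxAl -scalerA -c'E !mulmxA.
  have Ea : (Gamma0 *m Q ord0 *m Gamma0)^t* = Gamma0 *m Q ord0 *m Gamma0.
    by rewrite !adjM Ga Qa mulmxA.
  by exists (complex.Re (c * c')); rewrite -(hermitian_scale_real Ga Ea G_neq0 E).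
have s0 : site 0 = ord0 by exact: val_inj.
have sn : site (n - 0) = ord0 by rewrite subn0 inZp_size.
have pred0 : ord_pred (ord0 : 'I_n) = site p by rewrite -(inZp_size p) ord_pred_inZp.
have MQ k : M (site k) *m Q (site k.+1) = M (site k).
  by have [_ _ _ + _] := gQ (site k); rewrite ordS_inZp.
have QM k : Q (site k) *m M (site k) = M (site k) by have [] := gQ (site k).
have Qa k : (Q (site k))^t* = Q (site k) by have [_ _ _ _ []] := gQ (site k).
have QMa k : Q (site k.+1) *m (M (site k))^t* = (M (site k))^t*.
  by rewrite -{2}MQ adjM Qa.
have MaQ k : (M (site k))^t* *m Q (site k) = (M (site k))^t*.
  by rewrite -{2}QM adjM Qa.
have MMa k : M (site k) *m (M (site k))^t* = (g (site k))%:C *: Q (site k).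
  by have [] := gQ (site k).
have MaM k : (M (site k))^t* *m M (site k) = (g (site k))%:C *: Q (site k.+1).
  by have [_ + _ _ _] := gQ (site k); rewrite ordS_inZp.
(* The forward chain returns from site k + 1 to k by M_k M_k^*; the backward one returns from site n
   - k - 1 to n - k by M_(n-k-1)^* M_(n-k-1), whose scalar is that of index n - k - 1. *)
pose gs b k := if b then g (site k) else g (site (n - k.+1)).
pose om := (Q ord0 *m Gamma0) *t ket ord0.
(* At site 0 only M_0^* and M_(n-1) act, and both absorb Q_0 on their right; hence V has the same
   image on [P0] and on [om]. *)
have VPE (A : 'M[C]_m) : (M ord0)^t* *m A = (M ord0)^t* *m Gamma0 ->
    M (site p) *m A = M (site p) *m Gamma0 ->
  cyclic_V M *m (A *t ket ord0) = walk M Gamma0 true 1%N + walk M Gamma0 false 1%N.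
  by move=> A1 A2; rewrite cyclic_V_ket pred0 A1 A2 -[in ordS _]s0 ordS_inZp
    /walk /= subn1 s0.
apply: (@approximate_invariance R (m * n) p (cyclic_V M) P0 om
  (walk M Gamma0) gs q).
- case=> k kn.
    rewrite /walk cyclic_V_ket ordS_inZp ord_pred_inZp /=; congr (_ + _).
    rewrite !mulmxA MMa -!scalemxAl tensmxZl; congr (_ *: _).
    case: k kn => [|k] kn /=; first by rewrite s0.
    by rewrite mulmxA QMa.
  pose j := (n - k.+2)%N; have e1 : (n - k.+1 = j.+1)%N by rewrite /j; lia.
  have e2 : (j.+2 = n - k)%N by rewrite /j; lia.
  have -> : gs false k = g (site j.+1) by rewrite /gs e1.
  have -> : walk M Gamma0 false k.+1 = backward_op M Gamma0 k.+1 *t ket (site j.+1).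
    by rewrite /walk e1.
  have -> : walk M Gamma0 false k.+2
    = (M (site j) *m backward_op M Gamma0 k.+1) *t ket (site j) by [].
  rewrite cyclic_V_ket ordS_inZp ord_pred_inZp addrC; congr (_ + _).
  rewrite [backward_op _ _ _](_ : _ = M (site (n - k.+1)) *m backward_op M Gamma0 k) //.
  rewrite e1 mulmxA MaM -scalemxAl tensmxZl; congr (_ *: _).
  rewrite e2; case: k {kn j e1 e2} => [|k]; first by rewrite sn.
  rewrite [backward_op _ _ _](_ : _ = M (site (n - k.+1)) *m backward_op M Gamma0 k) //.
  by rewrite mulmxA QM.
- by apply: VPE.
- apply: VPE; rewrite mulmxA.
    by rewrite -s0 MaQ.
  by rewrite -[ord0]inZp_size MQ.
- by case: P0_proj.
- by rewrite tensmx_mul ket0_idem mulmxA qE tensmxZl.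
- case=> k kn; rewrite /walk tensmx_mul ket0_site ?tensmx0 //.
    by apply: site_neq0.
  by apply: site_neq0; lia.
Qed.

Lemma cyclic_expansion : exists (f : R -> R) (l0 K : R), 0 < l0 /\
  forall l, 0 <= l <= l0 ->
  forall d (E : 'I_d -> R) (phi : 'I_d -> 'cV[C]_(m * n)),
    ground_space_dim (- P0) d ->
    lowest_eigensystem (- P0 + l%:C *: cyclic_V M) E phi ->
  nrm (shifted_Heff E phi (f l)
       - ((-1) ^+ p * l%:C ^+ n) *: (Htarget Gamma0 M *t ket ord0))
    <= K * l ^+ n.+1.
Proof.
have [f [X [XO YO]]] := cyclic_approximate_invariance.
have e1 : Normc.normc ((-1) ^+ p : C) = 1.
  by apply: complexI; rewrite -[LHS]/(`|(-1) ^+ p : C|) normrX normrN1 expr1n.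
have [l0 [K [l00 H]]] :=
  shifted_Heff_expansion P0_proj P0_neq0 (cyclic_V_hermitian M) e1 XO YO.
exists f, l0, K; split=> // l l01 d E phi gd low.
have [_ GG] := Gproj.
by rewrite -Htarget_walk //; exact: H.
Qed.

(** For couplings away from 0 the shift 0 will do: H Pi is bounded because H is and Pi has the fixed
    rank of [P0]. *)
Lemma shifted_Heff_bounded (L : R) : 0 <= L -> exists2 B : R, 0 <= B &
  forall l, 0 <= l <= L ->
  forall d (E : 'I_d -> R) (phi : 'I_d -> 'cV[C]_(m * n)),
    ground_space_dim (- P0) d ->
    lowest_eigensystem (- P0 + l%:C *: cyclic_V M) E phi ->
  nrm (shifted_Heff E phi 0
       - ((-1) ^+ p * l%:C ^+ n) *: (Htarget Gamma0 M *t ket ord0)) <= B.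
Proof.
move=> L0; set T := Htarget Gamma0 M *t ket ord0; set V := cyclic_V M.
pose W : R := (m * n)%:R.
pose B1 := (nrm P0 + L * nrm V) * (W * (W * (1 + (\rank P0)%:R))).
exists (B1 + L ^+ n * nrm T).
  by rewrite /B1 /W !(addr_ge0, mulr_ge0, nrm_ge0, exprn_ge0).
move=> l /andP[l0 lL] d E phi gd [_ ortho eig].
apply: le_trans (nrmB _ _) _; rewrite lerD //.
  rewrite /shifted_Heff -[0%:C]/(0 : C) scale0r subr0 -(mulmx_low_projection eig).
  apply: le_trans (nrmM _ _) _; rewrite ler_pM ?nrm_ge0 //.
    apply: le_trans (nrmD _ _) _; rewrite nrmN nrmZ normcC ger0_norm //.
    by rewrite lerD2l ler_wpM2r ?nrm_ge0.
  rewrite nrm_projection // ?low_projection_trace //.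
    exact: low_projection_proj.
  by rewrite (ground_dimE P0_proj P0_neq0 gd).
rewrite nrmZ ler_wpM2r ?nrm_ge0 // Normc.normcM -rmorphXn normcC.
rewrite ger0_norm ?exprn_ge0 // (_ : Normc.normc _ = 1) ?mul1r; last first.
  by apply: complexI; rewrite -[LHS]/(`|(-1) ^+ p : C|) normrX normrN1 expr1n.
by rewrite lerXn2r.
Qed.

End CyclicExpansion.

(** * From small couplings to the whole admissible range *)

Theorem theorem1 (R : realType) (n m : nat) (n_gt0 : (0 < n)%N)
    (Gamma0 : 'M[R[i]]_m) (M : 'I_n -> 'M[R[i]]_m)
    (Gamma0_proj : orthogonal_projection Gamma0)
    (Gamma0_neq0 : Gamma0 <> 0)
    (hi : forall i : 'I_n,
       propto (M i *m M (ordS i) *m (M (ordS i))^t* *m (M i)^t*)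
              ((M i *m (M i)^t*) *m (M i *m (M i)^t*)))
    (hii : forall i : 'I_n,
       propto ((M i *m (M i)^t*) *m (M i *m (M i)^t*)) (M i *m (M i)^t*))
    (hiii : forall i : 'I_n,
       propto (M i *m (M i)^t*) ((M (ord_pred i))^t* *m M (ord_pred i)))
    (hiv : propto
       (Gamma0 *m M (Ordinal n_gt0) *m (M (Ordinal n_gt0))^t* *m Gamma0)
       Gamma0) :
  let ket0bra0 := ketbra R (Ordinal n_gt0) (Ordinal n_gt0) in
  let P0 := Gamma0 *t ket0bra0 in
  let H0 := - P0 in
  let V := cyclic_V M in
  let Mmax := \big[Num.max/0]_(i < n) opnorm (M i) in
  exists (f : R -> R) (K : R),
    forall lambda : R, 0 <= lambda -> lambda * (16 * Mmax) < 1 ->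
    forall (d : nat) (E : 'I_d -> R) (phi : 'I_d -> 'cV[R[i]]_(m * n)),
      ground_space_dim H0 d ->
      lowest_eigensystem (H0 + lambda%:C *: V) E phi ->
      opnorm (shifted_Heff E phi (f lambda)
              - ((-1) ^+ n.-1 * lambda%:C ^+ n)
                  *: (Htarget Gamma0 M *t ket0bra0))
        <= K * lambda ^+ n.+1.
Proof.
case: n n_gt0 M hi hii hiii hiv => // p n_gt0 M _ hii hiii.
have -> : Ordinal n_gt0 = ord0 by exact: val_inj.
move=> hiv ket0bra0 P0 H0 V Mmax.
have [f [l0 [K [l00 expand]]]] :=
  cyclic_expansion Gamma0_proj Gamma0_neq0 hii hiii hiv.
have Mle i : opnorm (M i) <= Mmax by exact: le_bigmax.
(* If all M_i vanish, lambda is unrestricted, but H does not depend on it and the target is zero;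
   the expansion at 0, whose error is 0, then serves for every lambda. *)
have [Mmax_gt0|Mmax_le0] := ltP 0 Mmax; last first.
  have M0 i : M i = 0 by apply: opnorm_eq0; exact: le_trans (Mle i) Mmax_le0.
  have V0 : V = 0.
    apply: big1 => i _; rewrite M0 trmx0 map_mx0 /ketbra.
    by rewrite !tens0mx addr0.
  have T0 : Htarget Gamma0 M = 0.
    by rewrite /Htarget !big_ord_recl !M0 trmx0 map_mx0 !mul0mx !mulmx0 !mul0mx addr0.
  exists (fun=> f 0), 0 => l _ _ d E phi gd low.
  rewrite mul0r (le_trans (opnorm_le_nrm _)) //.
  have := expand 0 _ d E phi gd _; rewrite T0 tens0mx !scaler0 subr0 exprS mul0r mulr0.
  apply; first by rewrite lexx ltW.
  by move: low; rewrite -/V V0 !scaler0.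
have [B B0 bounded] := @shifted_Heff_bounded R m p Gamma0 M Gamma0_proj Gamma0_neq0
  (16 * Mmax)^-1 (ltac:(by rewrite invr_ge0 mulr_ge0 // ltW)).
(* Beyond [l0] the bound [B], valid up to 1 / (16 Mmax), is at most B (l / l0)^(n+1), where n + 1 =
   p + 2; this is the second summand of the constant. *)
exists (fun l => if l <= l0 then f l else 0), (`|K| + B / l0 ^+ p.+2).
move=> l lge0 lM d E phi gd low.
rewrite (le_trans (opnorm_le_nrm _)) //.
have lp0 : 0 <= l ^+ p.+2 by rewrite exprn_ge0.
have l0p : 0 < l0 ^+ p.+2 by rewrite exprn_gt0.
case: (lerP l l0) => ll0.
  apply: le_trans (expand l _ d E phi gd low) _; first by rewrite lge0.
  rewrite ler_wpM2r // (le_trans (ler_norm _)) // lerDl.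
  by rewrite divr_ge0 // ltW.
have M16 : 0 < 16 * Mmax by rewrite mulr_gt0.
apply: le_trans (bounded l _ d E phi gd low) _.
  by rewrite lge0 -[_^-1]mul1r ler_pdivlMr // ltW.
rewrite mulrDl (@le_trans _ _ (B / l0 ^+ p.+2 * l ^+ p.+2)) //; last first.
  by rewrite lerDr mulr_ge0.
rewrite -mulrA ler_peMr // mulrC ler_pdivlMr // mul1r.
by rewrite lerXn2r ?nnegrE // ltW.
Qed.
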